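(* Let $V\in C^1(\mathbb{R}^n;\mathbb{R}_+)$, $\theta\in C^1(\mathbb{R}^n;\mathbb{R})$ be given functions with locally Lipschitz partial derivatives and suppose that $$S:=\{x\in\mathbb{R}^n:|\nabla V(x)|=0\}=\{x\in\mathbb{R}^n:V(x)=0\}.$$ Suppose that for every $z\in\mathbb{R}^n$ and for every $y\in\{x\in\mathbb{R}^n:V(x)\le V(z)\}$ the set $\{x\in\mathbb{R}^n:V(x)\le V(z),\ \theta(x)\le\theta(y)\}$ is compact. Let $\Omega\in C^0(\mathbb{R}^n;\mathbb{R}_+)$ be a locally Lipschitz function with $\Omega(x)>0$ for $x\notin S$ and $\Omega(x)=0$ for all $x\in S$. Suppose that there exist a function $\gamma\in C^0(\tilde S;(0,+\infty))$, where $\tilde S=\{x\in\mathbb{R}^n:\Omega(x)<1\}$, and a locally Lipschitz vector field $F:\mathbb{R}^n\to\mathbb{R}^n$ such that $$\gamma(x)|\nabla V(x)|^2\ge V(x)\quad\text{for all } x\in\mathbb{R}^n\text{ with }\Omega(x)<1,$$ $$\nabla V(x)F(x)\le0,\quad \nabla\theta(x)F(x)\le0\quad\text{for all } x\in\mathbb{R}^n.$$ Finally, suppose that there exist locally Lipschitz functions $\psi_i:\mathbb{R}^n\to(0,+\infty)$ ($i=1,2$) for which the following property holds: for every $z\in\mathbb{R}^n$ there exists $y_z\in\{x\in\mathbb{R}^n:V(x)\le V(z)\}$ with $\theta(y_z)\ge\theta(z)$ such that $$\{x\in\mathbb{R}^n:a(x)>0,\ V(x)\le V(z)\}\subseteq\{x\in\mathbb{R}^n:\theta(x)\le\theta(y_z)\},$$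 where $$a(x):=\psi_1(x)\nabla\theta(x)F(x)-\psi_2(x)\nabla V(x)(\nabla\theta(x))'-|\nabla V(x)|^2|\nabla\theta(x)|^2+\left|\nabla V(x)(\nabla\theta(x))'\right|^2 .$$ Let $\sigma:\mathbb{R}^n\to(0,+\infty)$ be a locally Lipschitz function and define the locally Lipschitz vector field $$f(x):=\sigma(x)\left(\psi_1(x)F(x)-\psi_2(x)(\nabla V(x))'-\left(|\nabla V(x)|^2I_n-(\nabla V(x))'\nabla V(x)\right)(\nabla\theta(x))'\right),\quad x\in\mathbb{R}^n.$$ Then: - For every $x_0\in\mathbb{R}^n$ the unique solution $x(t)$ of $\dot x=f(x)$ with $x(0)=x_0$ is defined for all $t\ge0$ and is bounded. - The set $S$ is positively invariant for $\dot x=f(x)$. - If $\omega(x_0)$ denotes the positive limit set of $\{x(t):t\ge0\}$, then for every $x_0\in\mathbb{R}^n$, $\omega(x_0)$ is a non-empty, compact, connected, invariant set which satisfies $\omega(x_0)\subseteq\{x\in S:\nabla\theta(x)F(x)=0\}$. - Every point $x^*\in S$ for which $F(x^* )=0$ and for which there is a constant $\tilde\delta>0$ such that $\theta(x^* )<\theta(x)$ for all $x\in S\setminus\{x^*\}$ with $|x-x^*|<\tilde\delta$ and $\{x\in S:\nabla\theta(x)F(x)=0,\ |x-x^*|<\tilde\delta\}=\{x^*\}$, is a locally asymptotically stable equilibrium point of $\dot x=f(x)$.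
   Context: Gradients are row vectors; a prime denotes transpose; $|\cdot|$ is the Euclidean norm; $I_n$ is the $n\times n$ identity matrix; $\mathbb{R}_+=[0,+\infty)$. The positive limit set $\omega(x_0)$ is the set of all $p\in\mathbb{R}^n$ for which there is a sequence $t_i\to+\infty$ with $x(t_i)\to p$. A set is invariant if the solution of $\dot x=f(x)$ starting at any of its points exists for all $t\in\mathbb{R}$ and stays in the set; positively invariant if solutions starting in it stay in it for all $t\ge0$. *)

(* Defs.v *)
From HB Require Import structures.
From mathcomp Require Import all_boot all_order all_algebra.
From mathcomp Require Import all_classical all_reals all_analysis.
Set Implicit Arguments.
Unset Strict Implicit.
Unset Printing Implicit Defensive.
Import Order.TTheory GRing.Theory Num.Theory.
Import numFieldNormedType.Exports.
Local Open Scope classical_set_scope.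
Local Open Scope ring_scope.

(* Points of R^n are column vectors, gradients are row vectors.  The topology
   (limits, compactness, boundedness, ...) is the library's one on matrices,
   induced by the sup norm; the Euclidean norm is [enorm]. *)

Definition enorm (R : realType) (m n : nat) (A : 'M[R]_(m, n)) : R :=
  Num.sqrt (\sum_i \sum_j A i j ^+ 2).

Definition rcprod (R : realType) (n : nat) (u : 'rV[R]_n) (v : 'cV[R]_n) : R :=
  (u *m v) 0 0.

Definition gradient (R : realType) (n : nat) (V : 'cV[R]_n -> R)
    (x : 'cV[R]_n) : 'rV[R]_n :=
  \row_i 'D_(delta_mx i 0) V x.

Definition is_C1 (R : realType) (n : nat) (V : 'cV[R]_n -> R) : Prop :=
  (forall x, differentiable V x) /\ continuous (gradient V).

(* The library's local Lipschitz condition asks for a Lipschitz constant near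
   each pair (x, y); near (x, x) this is the usual condition, and for x <> y it
   follows from it.  It does not depend on the choice of the norm. *)
Definition locally_lipschitz (R : realType) (n : nat) (W : normedModType R)
    (g : 'cV[R]_n -> W) : Prop :=
  [locally [lipschitz g x | x in setT]].

Section ODE.
Variables (R : realType) (n : nat).
Implicit Types (f : 'cV[R]_n -> 'cV[R]_n) (J : set R) (x : R -> 'cV[R]_n).

(* The derivative is taken within J, hence one-sided at endpoints in J. *)
Definition is_solution f J x : Prop :=
  forall t, J t ->
    (s - t)^-1 *: (x s - x t) @[s --> within J t^'] --> f (x t).

Definition is_unique_solution f J (x0 : 'cV[R]_n) x : Prop :=
  [/\ is_solution f J x, x 0 = x0 &
      forall (I : set R) (y : R -> 'cV[R]_n),
        is_interval I -> I 0 -> I `<=` J ->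
        is_solution f I y -> y 0 = x0 -> forall t, I t -> y t = x t].

Definition positively_invariant f (M : set 'cV[R]_n) : Prop :=
  forall p, M p -> exists x,
    is_unique_solution f `[0, +oo[ p x /\ forall t, 0 <= t -> M (x t).

Definition flow_invariant f (M : set 'cV[R]_n) : Prop :=
  forall p, M p -> exists x,
    is_unique_solution f setT p x /\ forall t, M (x t).

Definition positive_limit_set x : set 'cV[R]_n :=
  [set p | exists t : nat -> R,
     t i @[i --> \oo] --> +oo /\ x (t i) @[i --> \oo] --> p].

Definition lyapunov_stable f (xs : 'cV[R]_n) : Prop :=
  forall e : R, 0 < e -> exists2 d : R, 0 < d &
    forall x0 : 'cV[R]_n, enorm (x0 - xs) < d -> exists x,
      is_unique_solution f `[0, +oo[ x0 x /\
      forall t, 0 <= t -> enorm (x t - xs) < e.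

Definition locally_attractive f (xs : 'cV[R]_n) : Prop :=
  exists2 d : R, 0 < d &
    forall x0 : 'cV[R]_n, enorm (x0 - xs) < d -> exists x,
      is_unique_solution f `[0, +oo[ x0 x /\ x t @[t --> +oo] --> xs.

Definition locally_asymptotically_stable_equilibrium f (xs : 'cV[R]_n) : Prop :=
  [/\ f xs = 0, lyapunov_stable f xs & locally_attractive f xs].

End ODE.

Section VectorField.
Variables (R : realType) (n : nat).
Variables (V theta : 'cV[R]_n -> R) (F : 'cV[R]_n -> 'cV[R]_n).
Variables (psi1 psi2 sigma : 'cV[R]_n -> R).

Definition critical_set : set 'cV[R]_n := [set x | enorm (gradient V x) = 0].

Definition switching_fun (x : 'cV[R]_n) : R :=
  psi1 x * rcprod (gradient theta x) (F x)
  - psi2 x * rcprod (gradient V x) (gradient theta x)^T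
  - enorm (gradient V x) ^+ 2 * enorm (gradient theta x) ^+ 2
  + `|rcprod (gradient V x) (gradient theta x)^T| ^+ 2.

Definition closed_loop_field (x : 'cV[R]_n) : 'cV[R]_n :=
  sigma x *: (psi1 x *: F x - psi2 x *: (gradient V x)^T
    - ((enorm (gradient V x) ^+ 2)%:M - (gradient V x)^T *m gradient V x)
      *m (gradient theta x)^T).

End VectorField.

(* Main.v *)
Require Import Defs.
From HB Require Import structures.
From mathcomp Require Import all_boot all_order all_algebra.
From mathcomp Require Import all_classical all_reals all_analysis.
From mathcomp Require Import ring lra.
Set Implicit Arguments.
Unset Strict Implicit.
Unset Printing Implicit Defensive.
Import Order.TTheory GRing.Theory Num.Theory.
Import numFieldNormedType.Exports.
Local Open Scope classical_set_scope.
Local Open Scope ring_scope.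

(** The flow dissipates [V], since the derivative of [V] along the field is at
    most [- sigma * psi2 * |grad V|^2]; and [theta] cannot grow above the level
    [theta yz], because its derivative is [sigma] times the switching function.
    Trajectories are thus trapped in a compact sublevel set, which gives global
    existence, and the limit set lies in [S], as [V] is constant on it.  Near [S]
    the inequality [V <= gamma * |grad V|^2] makes [sqrt V] decrease at least as
    fast as a multiple of [|grad V|], while [theta] grows at most like
    [|grad V|]; so [theta + M * sqrt V] is nonincreasing for [M] large.  This
    function equals [theta] on [S], which forces [theta] to be constant on the
    limit set, and it serves as Lyapunov function at strict local minima of
    [theta] on [S].

    The ODE theory avoids integrals: a curve in a compact set solves the equation
    as soon as [|x s - x t - (s - t) f(x t)| <= C (s - t)^2], an estimate that
    passes to pointwise limits.  Ultrafilter limits of Euler polygons give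
    solutions, ultrafilter limits of time shifts give the orbits in limit sets. *)

(** * Real induction and Dini derivatives *)

(** Take the supremum of the times up to which [P] holds throughout: the left-limit clause gives [P]
    there, and the extension clause then pushes past it. *)
Lemma real_induction (R : realType) (a : R) (P : R -> Prop) :
  P a ->
  (forall t, a <= t -> (forall s, a <= s <= t -> P s) ->
     exists2 d, 0 < d & forall s, t < s < t + d -> P s) ->
  (forall t, a < t -> (forall s, a <= s < t -> P s) -> P t) ->
  forall t, a <= t -> P t.
Proof.
move=> Pa Pright Plim b ab; apply: contrapT => nPb.
pose A := [set t | a <= t /\ forall s, a <= s <= t -> P s].
have Aa : A a.
  by split=> // s; rewrite -eq_le => /eqP <-.
have Ab t : A t -> t <= b.
  by move=> [_ At]; rewrite leNgt; apply/negP => bt; apply/nPb/At; lra.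
have supA : has_sup A by split; [exists a | exists b => t /Ab].
have aA : a <= sup A by apply: ub_le_sup => //; exists b => t /Ab.
have Plt s : a <= s < sup A -> P s.
  case/andP=> a_s sA.
  have [|t [_ At] st] := sup_adherent (eps := sup A - s) _ supA; first lra.
  by apply: At; lra.
have PA : P (sup A).
  by move: aA; rewrite le_eqVlt => /predU1P[<- //|aA]; apply: Plim.
have Ple s : a <= s <= sup A -> P s.
  case/andP=> a_s; rewrite le_eqVlt => /predU1P[-> //|sA].
  by apply: Plt; rewrite a_s sA.
have [d d0 dP] := Pright _ aA Ple.
suff : sup A + d / 2 <= sup A by lra.
apply: ub_le_sup; first by exists b => t /Ab.
split; first lra.
move=> s /andP[a_s sd]; have [sA|sA] := leP s (sup A); first by apply: Ple; lra.
by apply: dP; lra.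
Qed.

(** The upper right Dini derivative is at most 0 and [g] does not jump up from the left, so real
    induction applies. No differentiability is asked, which admits norms, maxima and square
    roots. *)
Lemma dini_nonincreasing (R : realType) (a b : R) (g : R -> R) : a <= b ->
  (forall t, a <= t < b -> forall e, 0 < e -> exists2 d, 0 < d &
     forall s, t < s < t + d -> s <= b -> g s <= g t + e * (s - t)) ->
  (forall t, a < t <= b -> forall e, 0 < e -> exists2 d, 0 < d &
     forall s, a <= s -> t - d < s < t -> g t <= g s + e) ->
  g b <= g a.
Proof.
move=> ab gdini gleft.
(* The slack [e] makes the induction step strict enough to extend; it tends to 0 here. The [+ 1]
   avoids dividing by zero when [a = b]. *)
suff slope e : 0 < e -> g b <= g a + e * (b - a).
  apply/ler_addgt0Pr => e e0; have ba : 0 < b - a + 1 by lra.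
  apply: le_trans (slope (e / (b - a + 1)) _) _; first exact: divr_gt0.
  by rewrite lerD2l mulrAC ler_pdivrMr// ler_pM2l//; lra.
move=> e0; apply: (@real_induction _ a
  (fun t => t <= b -> g t <= g a + e * (t - a))) => //.
- by rewrite subrr mulr0 addr0.
- move=> t a_t Pt; have [bt|tb] := leP b t.
    by exists 1 => // s ts sb; lra.
  have [|d d0 dP] := gdini t _ e e0; first by rewrite a_t.
  exists d => // s ts sb; apply: le_trans (dP _ ts sb) _.
  have := Pt t; rewrite a_t lexx => /(_ isT (ltW tb)) gt.
  by nra.
- move=> t a_t Pt tb; apply/ler_addgt0Pr => h h0.
  have [|d d0 dP] := gleft t _ h h0; first by rewrite a_t.
  pose s := Num.max a (t - d / 2).
  have st : s < t by rewrite gt_max a_t; lra.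
  have a_s : a <= s by rewrite le_max lexx.
  have ds : t - d < s by rewrite lt_max; apply/orP; right; lra.
  have := dP s a_s; rewrite ds st => /(_ isT).
  have := Pt s; rewrite a_s st => /(_ isT) /(_ _).
  move=> /(_ (le_trans (ltW st) tb)); nra.
Qed.

(** A division-free form of the one-sided difference quotient: [s = t] is allowed, and remainders
    can be added by the triangle inequality. *)
Definition has_deriv_within (R : realType) (W : normedModType R) (J : set R)
    (x : R -> W) (t : R) (l : W) : Prop :=
  forall e : R, 0 < e -> exists2 d : R, 0 < d & forall s : R, J s -> `|s - t| < d ->
    `|x s - x t - (s - t) *: l| <= e * `|s - t|.

Lemma has_deriv_withinP (R : realType) (W : normedModType R) (J : set R)
    (x : R -> W) (t : R) (l : W) :
  (s - t)^-1 *: (x s - x t) @[s --> within J t^'] --> l <->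
  has_deriv_within J x t l.
Proof.
have key (e s : R) : s != t ->
    (`|l - (s - t)^-1 *: (x s - x t)| <= e) =
    (`|x s - x t - (s - t) *: l| <= e * `|s - t|).
  move=> st; have st0 : s - t != 0 by rewrite subr_eq0.
  rewrite -[in RHS]ler_pdivrMr ?normr_gt0// [in RHS]mulrC -normfV -normrZ.
  by rewrite [in RHS]scalerBr scalerA mulVf// scale1r distrC.
split=> [/cvgrPdist_le xl e e0|xl].
  have /nbhs_ballP[d /= d0 dP] := xl e e0.
  exists d => // s Js std; have [->|st] := eqVneq s t.
    by rewrite !subrr scale0r subr0 !normr0 mulr0.
  by rewrite -key//; apply: dP => //; rewrite /ball/= distrC.
apply/cvgrPdist_le => e e0; have [d d0 dP] := xl e e0.
apply/nbhs_ballP; exists d => //= s; rewrite /ball/= distrC => std st Js.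
by rewrite key//; apply: dP.
Qed.

Lemma is_solutionP (R : realType) n (f : 'cV[R]_n -> 'cV[R]_n) J x :
  is_solution f J x <->
  forall t, J t -> has_deriv_within J x t (f (x t)).
Proof.
by split=> fx t /fx; [move/has_deriv_withinP|move=> ?; apply/has_deriv_withinP].
Qed.

Lemma has_deriv_within_cvg (R : realType) (W : normedModType R) (J : set R)
    (x : R -> W) (t : R) (l : W) : has_deriv_within J x t l ->
  x s @[s --> within J (nbhs t)] --> x t.
Proof.
move=> xl; apply/cvgrPdist_le => e e0; have [d d0 dP] := xl 1 ltr01.
pose c := 1 + `|l|; have c0 : 0 < c by rewrite ltr_pwDl.
apply/nbhs_ballP; exists (Num.min d (e / c)) => /=.
  by rewrite lt_min d0 divr_gt0.
move=> s; rewrite /ball/= lt_min distrC => /andP[sd se] Js.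
rewrite distrC -[x s - x t](subrK ((s - t) *: l)).
apply: le_trans (ler_normD _ _) _.
apply: le_trans (lerD (dP _ Js sd) (lexx _)) _.
rewrite normrZ mulrC -mulrDr -/c -ler_pdivlMr//; exact: ltW.
Qed.

Lemma within_cvgP (R : realType) (W : normedModType R) (J : set R)
    (x : R -> W) (t : R) :
  x s @[s --> within J (nbhs t)] --> x t ->
  forall e, 0 < e -> exists2 d, 0 < d &
    forall s, J s -> `|s - t| < d -> `|x s - x t| < e.
Proof.
move=> /cvgrPdist_lt xt e /xt /nbhs_ballP[d d0 dP]; exists d => // s Js std.
by rewrite distrC; apply: dP => //; rewrite /ball/= distrC.
Qed.

(** * Norms, compactness and gradients *)

(** An ultrafilter missing a neighbourhood of its cluster point would contain the complement. One
    ultrafilter gives limits at all times at once, so no diagonal extraction of subsequences is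
    needed. *)
Lemma ultra_cvg_compact (I : Type) (T : topologicalType) (F : set_system I)
    (f : I -> T) (K : set T) : UltraFilter F -> compact K -> F (f @^-1` K) ->
  exists2 p, K p & f @ F --> p.
Proof.
move=> FU cK FK; have [p [Kp pF]] := cK (f @ F) _ FK.
exists p => // A Ap; have [//|FnA] := in_ultra_setVsetC (f @^-1` A) FU.
by have [q []] := pF (~` A) A FnA Ap.
Qed.

Lemma entry_le_norm (R : realType) m n (x : 'M[R]_(m, n)) i j :
  `|x i j| <= `|x|.
Proof.
by rewrite [leRHS]/Num.norm/= mx_normrE; apply/bigmax_geP; right; exists (i, j).
Qed.

Lemma norm_le_entry (R : realType) m n (x : 'M[R]_(m, n)) c : 0 <= c ->
  (forall i j, `|x i j| <= c) -> `|x| <= c.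
Proof.
move=> c0 xc; rewrite [leLHS]/Num.norm/= mx_normrE.
by apply/bigmax_leP; split => // -[i j] _; exact: xc.
Qed.

Lemma trmx_continuous (R : realType) m n :
  continuous (@trmx R m n).
Proof.
move=> x A /nbhs_ballP[e e0 eA]; apply/nbhs_ballP; exists e => // y [_ xy].
by apply: eA; split=> // i j; rewrite !mxE; exact: xy.
Qed.

Lemma dist_continuous (R : realType) (W : normedModType R) (c : W) :
  continuous (fun x => `|x - c|).
Proof.
move=> x; apply: (@continuous_comp _ _ _ (fun x => x - c) (fun x => `|x|)).
  by apply: cvgB; [exact: cvg_id|exact: cvg_cst].
exact: norm_continuous.
Qed.

Lemma continuous_at_normP (R : realType) (V W : normedModType R) (g : V -> W)
    (p : V) : {for p, continuous g} <->
  forall e : R, 0 < e -> exists2 d : R, 0 < d &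
    forall q, `|q - p| < d -> `|g q - g p| < e.
Proof.
split=> [/cvgrPdist_lt gp e /gp /nbhs_ballP[d d0 dP]|gp].
  exists d => // q qd; rewrite distrC; apply: dP.
  by rewrite -ball_normE/= distrC.
apply/cvgrPdist_lt => e e0; have [d d0 dP] := gp e e0.
apply/nbhs_ballP; exists d => //= q; rewrite -ball_normE/= distrC => qd.
by rewrite distrC; exact: dP.
Qed.

(** Heine-Borel is applied to row vectors and carried to columns by the continuous transposition. *)
Lemma closed_ball_compact (R : realType) n (c : 'cV[R]_n) (r : R) :
  compact [set x | `|x - c| <= r].
Proof.
have -> : [set x | `|x - c| <= r] = trmx @` [set y | `|y^T - c| <= r].
  rewrite eqEsubset; split=> [x /= xc|_ [y yc <-]//].
  by exists x^T => //=; rewrite trmxK.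
apply: continuous_compact.
  by apply: continuous_subspaceT => x; exact: trmx_continuous.
apply: bounded_closed_compact.
  exists (r + `|c|); split=> [|M rM y /= yc]; first exact: num_real.
  apply: (@norm_le_entry R 1 n y M) => [|i j].
    by apply: le_trans _ (ltW rM); rewrite addr_ge0// (le_trans _ yc).
  have -> : y i j = y^T j i by rewrite mxE.
  apply: le_trans (entry_le_norm _ _ _) _; apply: le_trans _ (ltW rM).
  by rewrite -[y^T](subrK c); apply: le_trans (ler_normD _ _) _; rewrite lerD2r.
apply: (@closed_comp _ _ (fun y : 'rV[R]_n => `|y^T - c|) [set t | t <= r]).
  move=> y _; apply: (@continuous_comp _ _ _ trmx (fun x => `|x - c|)).
    exact: trmx_continuous.
  exact: dist_continuous.
exact: closed_le.
Qed.

Lemma norm_le_enorm (R : realType) n (x : 'cV[R]_n) : `|x| <= enorm x.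
Proof.
apply: norm_le_entry => [|i j]; first exact: sqrtr_ge0.
rewrite -sqrtr_sqr ler_wsqrtr// [in leRHS](bigD1 i)//= [in leRHS](bigD1 j)//=.
rewrite -addrA lerDl addr_ge0//; first by apply: sumr_ge0 => k _; exact: sqr_ge0.
by apply: sumr_ge0 => k _; apply: sumr_ge0 => l _; exact: sqr_ge0.
Qed.

(** The constant is not sharp; [n.+1] is positive even for [n = 0], so that one may divide by it. *)
Lemma enorm_le_norm (R : realType) n (x : 'cV[R]_n) :
  enorm x <= n.+1%:R * `|x|.
Proof.
rewrite -[leRHS]ger0_norm ?mulr_ge0// -sqrtr_sqr ler_wsqrtr//.
apply: (@le_trans _ _ (\sum_(i < n) `|x| ^+ 2)).
  apply: ler_sum => i _; rewrite big_ord1 -real_normK ?num_real//.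
  by rewrite lerXn2r ?nnegrE// entry_le_norm.
rewrite sumr_const card_ord -[leLHS]mulr_natl exprMn ler_wpM2r ?sqr_ge0//.
by rewrite -natrX ler_nat (leq_trans (leqnSn n))// expnS expn1 leq_pmulr.
Qed.

Definition lipschitz_over (R : realType) (V W : normedModType R) (A : set V)
    (g : V -> W) : Prop :=
  exists2 L : R, 0 <= L & forall x y, A x -> A y -> `|g x - g y| <= L * `|x - y|.

(** The local condition bounds the quotient near every pair of points, also off the diagonal, so
    compactness of [A * A] yields one constant without convexity of [A]. *)
Lemma locally_lipschitz_compact (R : realType) n (W : normedModType R)
    (g : 'cV[R]_n -> W) (A : set 'cV[R]_n) :
  locally_lipschitz g -> compact A -> lipschitz_over A g.
Proof.
move=> glip cA; have cAA := compact_setX cA cA.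
have {cAA} : \forall L \near +oo, A `*` A `<=`
    (fun p => `|g p.1 - g p.2| <= L * `|p.1 - p.2|).
  move/compact_near_coveringP : cAA; apply => p _.
  have : lipschitz_on g (within (setT `*` setT) (nbhs p)) by exact: (glip p).
  move=> /pinfty_ex_gt0[M M0 Mp].
  have {}Mp : \forall q \near p, `|g q.1 - g q.2| <= M * `|q.1 - q.2|.
    by apply: (@filterS _ (nbhs p) _ _ _ _ Mp) => q /= /(_ (conj I I)).
  exists ([set q | `|g q.1 - g q.2| <= M * `|q.1 - q.2|], [set L | M <= L]).
    by split=> /=; [exact: Mp|exact: nbhs_pinfty_ge (num_real M)].
  move=> [q L] /= [qM ML]; apply: le_trans qM _; exact: ler_wpM2r.
move=> /pinfty_ex_gt0[L L0 LA]; exists L; first exact: ltW.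
by move=> x y Ax Ay; exact: (LA (x, y)).
Qed.

Lemma differentiable_gradient (R : realType) n (g : 'cV[R]_n -> R) p :
  differentiable g p -> forall e, 0 < e -> exists2 d, 0 < d & forall q,
    `|q - p| < d -> `|g q - g p - rcprod (gradient g p) (q - p)| <= e * `|q - p|.
Proof.
move=> dg e e0.
(* By linearity the differential is determined by its values on the basis vectors, the partial
   derivatives. *)
have dgE h : 'd g p h = rcprod (gradient g p) h.
  rewrite {1}(matrix_sum_delta h) linear_sum/= /rcprod mxE; apply: eq_bigr => i _.
  by rewrite big_ord1 linearZ/= mxE deriveE// mulrC.
have /eqaddoP/(_ e e0)/nbhs_ballP[d d0 dP] := diff_locally dg.
exists d => // q qd; have /= := dP (q - p).
rewrite -ball_normE/= sub0r normrN => /(_ qd).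
by rewrite !fctE/= subrK dgE opprD addrA.
Qed.

Lemma rcprod_le_norm (R : realType) n (G : 'rV[R]_n) :
  exists2 M, 0 < M & forall h, `|rcprod G h| <= M * `|h|.
Proof.
exists (\sum_i `|G 0 i| + 1) => [|h]; first by rewrite ltr_wpDl ?sumr_ge0.
rewrite /rcprod mxE (le_trans (ler_norm_sum _ _ _))//.
apply: (@le_trans _ _ ((\sum_i `|G 0 i|) * `|h|)); last first.
  by rewrite ler_wpM2r// lerDl.
by rewrite mulr_suml; apply: ler_sum => i _; rewrite normrM ler_wpM2l// entry_le_norm.
Qed.

Lemma rcprodD (R : realType) n (G : 'rV[R]_n) u v :
  rcprod G (u + v) = rcprod G u + rcprod G v.
Proof. by rewrite /rcprod mulmxDr mxE. Qed.

Lemma rcprodZ (R : realType) n (G : 'rV[R]_n) k u :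
  rcprod G (k *: u) = k * rcprod G u.
Proof. by rewrite /rcprod -scalemxAr mxE. Qed.

Lemma has_deriv_within_comp (R : realType) n (g : 'cV[R]_n -> R) J x t l :
  differentiable g (x t) -> has_deriv_within J x t l ->
  has_deriv_within J (g \o x) t (rcprod (gradient g (x t)) l).
Proof.
move=> dg xl e e0; set G := gradient g (x t).
have [M M0 GM] := rcprod_le_norm G.
(* Near [t] the curve moves at speed at most [c]. Half of [e] pays for the remainder of [g], the
   other half for that of [x] multiplied by the gradient. *)
pose c := `|l| + 1; have c0 : 0 < c by rewrite ltr_wpDl.
have ec0 : 0 < e / 2 / c by rewrite !divr_gt0.
have [d d0 dP] := differentiable_gradient dg ec0.
have [d2 d20 d2P] := within_cvgP (has_deriv_within_cvg xl) d0.
have m0 : 0 < Num.min 1 (e / 2 / M) by rewrite lt_min ltr01 !divr_gt0.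
have [d1 d10 d1P] := xl _ m0.
exists (Num.min d1 d2); first by rewrite lt_min d10.
move=> s Js; rewrite lt_min => /andP[sd1 sd2] /=.
have r1 := d1P s Js sd1; have r2 := dP _ (d2P s Js sd2).
set u := x s - x t - (s - t) *: l in r1 *.
have xE : x s - x t = (s - t) *: l + u by rewrite /u addrCA subrr addr0.
clearbody u.
have xst : `|x s - x t| <= c * `|s - t|.
  rewrite xE (le_trans (ler_normD _ _))// normrZ /c mulrDl mul1r.
  rewrite mulrC lerD2l (le_trans r1)// -[leRHS]mul1r ler_wpM2r//.
  by rewrite ge_min lexx.
rewrite -[X in `|X|](subrK (rcprod G u)) (le_trans (ler_normD _ _))//.
have -> : e * `|s - t| = e / 2 * `|s - t| + e / 2 * `|s - t| by lra.
apply: lerD.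
  have -> : g (x s) - g (x t) - (s - t) *: rcprod G l - rcprod G u =
      g (x s) - g (x t) - rcprod G (x s - x t).
    by rewrite xE rcprodD rcprodZ opprD addrA.
  apply: le_trans r2 _; apply: le_trans (ler_wpM2l (ltW ec0) xst) _.
  by rewrite mulrA divfK// gt_eqF.
apply: le_trans (GM u) _; apply: le_trans (ler_wpM2l (ltW M0) r1) _.
rewrite mulrA ler_wpM2r// mulrC -ler_pdivlMr// ge_min lexx orbT//.
Qed.

(** * Uniqueness and existence of solutions *)

(** The working form of local Lipschitz continuity, which implies it because closed balls are
    compact. It is easy to propagate through sums and products. *)
Definition lipschitz_on_balls (R : realType) (V W : normedModType R)
    (g : V -> W) : Prop :=
  forall r, lipschitz_over [set x | `|x| <= r] g.

Lemma lipschitz_on_balls_continuous (R : realType) (V W : normedModType R)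
    (g : V -> W) : lipschitz_on_balls g -> continuous g.
Proof.
move=> glip p; have [L L0 gL] := glip (`|p| + 1).
apply/continuous_at_normP => e e0; exists (Num.min 1 (e / (L + 1))).
  by rewrite lt_min ltr01 divr_gt0// ltr_wpDl.
move=> q; rewrite lt_min ltr_pdivlMr ?ltr_wpDl// => /andP[q1 qe].
apply: le_lt_trans (gL _ _ _ _) _ => /=.
- rewrite -[q](subrK p) (le_trans (ler_normD _ _))// addrC lerD2l ltW//.
- by rewrite lerDl.
- by apply: le_lt_trans _ qe; rewrite mulrC ler_wpM2l// lerDl.
Qed.

Lemma has_deriv_withinW (R : realType) (W : normedModType R) (I J : set R)
    (x : R -> W) t l : I `<=` J -> has_deriv_within J x t l ->
  has_deriv_within I x t l.
Proof. by move=> IJ xl e /xl[d d0 dP]; exists d => // s /IJ; exact: dP. Qed.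

Lemma is_solutionW (R : realType) n (f : 'cV[R]_n -> 'cV[R]_n) I J x :
  I `<=` J -> is_solution f J x -> is_solution f I x.
Proof.
move=> IJ /is_solutionP xJ; apply/is_solutionP => t /IJ /xJ.
exact: has_deriv_withinW.
Qed.

Lemma solution_cvg (R : realType) n (f : 'cV[R]_n -> 'cV[R]_n) J x t :
  is_solution f J x -> J t -> forall e, 0 < e -> exists2 d, 0 < d &
    forall s, J s -> `|s - t| < d -> `|x s - x t| < e.
Proof.
by move=> /is_solutionP xJ /xJ xt; apply: within_cvgP (has_deriv_within_cvg xt).
Qed.

(** The function [|x s - x a| - B * (s - a)] has nonpositive Dini derivative by the triangle
    inequality. *)
Lemma mean_value_inequality (R : realType) (W : normedModType R) (a b B : R)
    (x dx : R -> W) : a <= b ->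
  (forall t, a <= t <= b -> has_deriv_within `[a, b] x t (dx t)) ->
  (forall t, a <= t <= b -> `|dx t| <= B) -> `|x b - x a| <= B * (b - a).
Proof.
move=> ab xdx dxB; pose g s := `|x s - x a| - B * (s - a).
suff : g b <= g a by rewrite /g !subrr normr0 mulr0 subr0 subr_le0.
have incr s t : `|x s - x a| <= `|x t - x a| + `|x s - x t|.
  by rewrite [leRHS]addrC -[x s - x a](subrKA (x t)) ler_normD.
apply: dini_nonincreasing => // t tab e e0.
  have tab' : a <= t <= b by lra.
  have [d d0 dP] := xdx t tab' e e0; exists d => // s std sb.
  have sab : `[a, b]%classic s by rewrite /= in_itv/=; lra.
  have sd : `|s - t| < d by rewrite gtr0_norm; lra.
  have xst := dP s sab sd.
  have st : `|x s - x t| <= e * (s - t) + B * (s - t).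
    rewrite -[X in `|X|](subrK ((s - t) *: dx t)) (le_trans (ler_normD _ _))//.
    have st0 : `|s - t| = s - t by rewrite gtr0_norm; lra.
    rewrite st0 in xst; rewrite lerD// normrZ st0 mulrC ler_wpM2r// ?dxB//; lra.
  by have := incr s t; rewrite /g; lra.
have tab' : a <= t <= b by lra.
have B0 : 0 <= B by apply: le_trans (dxB t tab').
have e20 : 0 < e by lra.
have [d d0 dP] := within_cvgP (has_deriv_within_cvg (xdx t tab')) e20.
exists d => // s a_s std.
have sab : `[a, b]%classic s by rewrite /= in_itv/=; lra.
have sd : `|s - t| < d by rewrite ltr0_norm; lra.
have xst := dP s sab sd.
have := incr t s; rewrite distrC in xst; rewrite /g.
have : B * (s - a) <= B * (t - a) by rewrite ler_wpM2l//; lra.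
by lra.
Qed.

Lemma has_deriv_withinB (R : realType) (W : normedModType R) J
    (x y : R -> W) t k l : has_deriv_within J x t k ->
  has_deriv_within J y t l -> has_deriv_within J (fun s => x s - y s) t (k - l).
Proof.
move=> xk yl e e0; have e20 : 0 < e / 2 by lra.
have [d d0 dP] := xk _ e20; have [d' d'0 d'P] := yl _ e20.
exists (Num.min d d'); first by rewrite lt_min d0.
move=> s Js; rewrite lt_min => /andP[/(dP s Js) xst /(d'P s Js) yst].
have -> : x s - y s - (x t - y t) - (s - t) *: (k - l) =
    (x s - x t - (s - t) *: k) - (y s - y t - (s - t) *: l).
  by rewrite scalerBr !opprD !opprK [X in X + _ = _]addrACA [LHS]addrACA.
rewrite (le_trans (ler_normB _ _))//; lra.
Qed.

Lemma has_deriv_within_scale (R : realType) (W : normedModType R) J t (v : W) :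
  has_deriv_within J (fun s => s *: v) t v.
Proof.
by move=> e e0; exists 1 => // s _ _; rewrite -scalerBl subrr normr0 mulr_ge0// ltW.
Qed.

Lemma has_deriv_within_opp (R : realType) (W : normedModType R) J
    (x : R -> W) t l : has_deriv_within J x (- t) l ->
  has_deriv_within [set s | J (- s)] (x \o -%R) t (- l).
Proof.
move=> xl e /xl[d d0 dP]; exists d => // s Js std.
have sE : - s - (- t) = - (s - t) by rewrite opprB opprK addrC.
by have := dP _ Js; rewrite /= sE normrN scaleNr scalerN; apply.
Qed.

(** In the limit the error [eta] disappears and a bound [C * |s - t| ^+ 2] remains, which contains
    the derivative. The terms in [eta] leave room for approximate solutions with small jumps. *)
Lemma has_deriv_within_limit (R : realType) (W : normedModType R) (f : W -> W)
    (I : topologicalType) (U : set_system I) {PU : ProperFilter U}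
    (J : set R) (X : I -> R -> W) (x : R -> W) (C : R) (eta : I -> R) :
  continuous f -> 0 <= C -> (forall t, J t -> X i t @[i --> U] --> x t) ->
  eta i @[i --> U] --> (0 : R) ->
  (forall s t, J s -> J t -> \forall i \near U,
     `|X i s - X i t - (s - t) *: f (X i t)| <=
     C * (`|s - t| + eta i) ^+ 2 + C * eta i) ->
  forall t, J t -> has_deriv_within J x t (f (x t)).
Proof.
move=> fc C0 Xx eta0 est t Jt.
have quad s : J s -> `|x s - x t - (s - t) *: f (x t)| <= C * `|s - t| ^+ 2.
  move=> Js; have -> : C * `|s - t| ^+ 2 = C * (`|s - t| + 0) ^+ 2 + C * 0.
    by rewrite addr0 mulr0 addr0.
  apply: (ler_cvg_to _ _ (est s t Js Jt)).
    apply: cvg_norm; apply: cvgB; first by apply: cvgB; exact: Xx.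
    apply: cvgZl_tmp; exact: (cvg_comp _ _ (Xx t Jt) (fc (x t))).
  apply: cvgD; apply: cvgM => //; try exact: cvg_cst.
  by apply: cvgM; apply: cvgD => //; exact: cvg_cst.
move=> e e0; exists (e / (C + 1)) => [|s Js].
  by rewrite divr_gt0// ltr_wpDl.
rewrite ltr_pdivlMr ?ltr_wpDl// => ste; apply: le_trans (quad s Js) _.
rewrite expr2 mulrA ler_wpM2r//; apply: le_trans (ltW ste).
by rewrite mulrC ler_wpM2l// lerDl.
Qed.

Section ODE.
Context (R : realType) (n : nat).
Implicit Types (f : 'cV[R]_n -> 'cV[R]_n) (x y : R -> 'cV[R]_n) (A : set 'cV[R]_n).

Lemma solution_speed f A x a b B : a <= b -> is_solution f `[a, b] x ->
  (forall t, a <= t <= b -> A (x t)) -> (forall p, A p -> `|f p| <= B) ->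
  `|x b - x a| <= B * (b - a).
Proof.
move=> ab /is_solutionP xs xA fB.
apply: (@mean_value_inequality _ _ a b B x (f \o x)) => // t tab.
exact/fB/xA.
Qed.

(** On an interval of length [l] the curve moves by at most [B * l], so its velocity varies by at
    most [L * B * l]; the mean value inequality for [x s - s *: f (x c)] adds another factor [l]. *)
Lemma solution_quadratic f A J x L B : 0 <= L -> is_interval J ->
  is_solution f J x -> (forall t, J t -> A (x t)) ->
  (forall p, A p -> `|f p| <= B) ->
  (forall p q, A p -> A q -> `|f p - f q| <= L * `|p - q|) ->
  forall s t, J s -> J t ->
    `|x s - x t - (s - t) *: f (x t)| <= L * B * `|s - t| ^+ 2.
Proof.
move=> L0 iJ xJ xA fB fL.
have sub a b : J a -> J b -> `[a, b] `<=` J.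
  by move=> Ja Jb t; rewrite /= in_itv/=; exact: iJ.
(* The base point [c] will be either end of the interval, according to the order of [s] and [t]. *)
have key a b c : a <= b -> J a -> J b -> a <= c <= b ->
    `|x b - x a - (b - a) *: f (x c)| <= L * B * (b - a) ^+ 2.
  move=> ab Ja Jb cab; have Jc : J c by apply: (iJ a b).
  have abJ := sub _ _ Ja Jb.
  have JP t : a <= t <= b -> J t by move=> tab; apply: abJ; rewrite /= in_itv.
  have B0 : 0 <= B by apply: le_trans (fB _ (xA _ Ja)).
  have speed u v : a <= u -> u <= v -> v <= b -> `|x v - x u| <= B * (b - a).
    move=> au uv vb.
    apply: (@le_trans _ _ (B * (v - u))); last by rewrite ler_wpM2l//; lra.
    apply: (solution_speed (f := f) (A := A)) => // [|t tuv].
      apply: is_solutionW xJ => t; rewrite /= in_itv/= => tuv; apply: JP; lra.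
    by apply/xA/JP; lra.
  have speed2 u v : a <= u <= b -> a <= v <= b -> `|x v - x u| <= B * (b - a).
    move=> uab vab; have [uv|/ltW uv] := leP u v; first by apply: speed; lra.
    by rewrite distrC; apply: speed; lra.
  have -> : x b - x a - (b - a) *: f (x c) =
      (x b - b *: f (x c)) - (x a - a *: f (x c)).
    by rewrite scalerBl !opprD !opprK addrACA.
  have -> : L * B * (b - a) ^+ 2 = L * (B * (b - a)) * (b - a) by ring.
  apply: (mean_value_inequality (x := fun s => x s - s *: f (x c))
     (dx := fun t => f (x t) - f (x c))) => // t tab.
    apply: has_deriv_withinB; last exact: has_deriv_within_scale.
    by move/is_solutionP: xJ => xJ; apply: has_deriv_withinW (xJ _ (JP _ tab)).
  apply: le_trans (fL _ _ (xA _ (JP _ tab)) (xA _ Jc)) _.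
  by rewrite ler_wpM2l//; apply: speed2.
move=> s t Js Jt; have [ts|/ltW st] := leP t s.
  rewrite ger0_norm ?subr_ge0//; apply: key => //; lra.
have -> : x s - x t - (s - t) *: f (x t) = - (x t - x s - (t - s) *: f (x t)).
  by rewrite -[s - t]opprB scaleNr opprK opprD opprB opprK.
rewrite normrN [`|s - t|]distrC ger0_norm ?subr_ge0//; apply: (key s t t) => //; lra.
Qed.

Lemma solution_limit f (I : topologicalType) (U : set_system I) {PU : ProperFilter U}
    (J : set R) (X : I -> R -> 'cV[R]_n) x (C : R) (eta : I -> R) :
  continuous f -> 0 <= C -> (forall t, J t -> X i t @[i --> U] --> x t) ->
  eta i @[i --> U] --> (0 : R) ->
  (forall s t, J s -> J t -> \forall i \near U,
     `|X i s - X i t - (s - t) *: f (X i t)| <=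
     C * (`|s - t| + eta i) ^+ 2 + C * eta i) ->
  is_solution f J x.
Proof.
move=> fc C0 Xx eta0 est; apply/is_solutionP => t Jt.
exact: (has_deriv_within_limit fc C0 Xx eta0 est Jt).
Qed.
End ODE.

Section uniqueness.
Context (R : realType) (n : nat).
Implicit Types (f : 'cV[R]_n -> 'cV[R]_n) (x y : R -> 'cV[R]_n) (A : set 'cV[R]_n).

(** Gronwall's inequality in differential form: the distance weighted by [expR (- (L * t))] is
    nonincreasing and starts at 0. *)
Lemma gronwall_unique f A x y T : 0 <= T -> lipschitz_over A f ->
  is_solution f `[0, T] x -> is_solution f `[0, T] y ->
  (forall t, 0 <= t <= T -> A (x t) /\ A (y t)) -> x 0 = y 0 -> x T = y T.
Proof.
move=> T0 [L L0 fL] xs ys xyA xy0.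
pose h t := `|x t - y t| * expR (- (L * t)).
suff : h T <= h 0.
  rewrite /h xy0 subrr normr0 mul0r pmulr_lle0 ?expR_gt0// normr_le0 subr_eq0.
  by move/eqP.
have in0T t : 0 <= t <= T -> `[0, T]%classic t by rewrite /= in_itv.
have deriv t : 0 <= t <= T ->
    has_deriv_within `[0, T] (fun s => x s - y s) t (f (x t) - f (y t)).
  move=> /in0T tT; apply: has_deriv_withinB.
    by move/is_solutionP : xs; apply.
  by move/is_solutionP : ys; apply.
apply: dini_nonincreasing => // t tT e e0.
  have {}tT : 0 <= t <= T by lra.
  have [d d0 dP] := deriv t tT e e0; exists d => // s std sT.
  have sd : `|s - t| < d by rewrite gtr0_norm; lra.
  have := dP s (in0T s ltac:(lra)) sd; rewrite gtr0_norm; last by lra.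
  set u := x s - y s; set v := x t - y t; set w := f (x t) - f (y t) => uvw.
  have [xt yt] := xyA t tT.
  have wL : `|w| <= L * `|v| by exact: fL.
  have us : `|u| <= `|v| * (1 + L * (s - t)) + e * (s - t).
    rewrite -[u](subrK v) -[u - v](subrK ((s - t) *: w)).
    rewrite (le_trans (ler_normD _ _))// mulrDr mulr1 addrC -[leRHS]addrA lerD2l.
    rewrite (le_trans (ler_normD _ _))// [leRHS]addrC lerD// normrZ gtr0_norm; last lra.
    by rewrite mulrA [_ * L]mulrC [leRHS]mulrC ler_wpM2l//; lra.
  rewrite /h -/u -/v; apply: le_trans (ler_wpM2r (expR_ge0 _) us) _.
  rewrite mulrDl lerD//.
    rewrite -mulrA ler_wpM2l//.
    (* The growth factor [1 + L * (s - t)] is at most [expR (L * (s - t))], which the weight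
       absorbs. *)
    have -> : - (L * t) = L * (s - t) - L * s by ring.
    by rewrite expRD ler_wpM2r ?expR_ge0// expR_ge1Dx.
  have est0 : 0 <= e * (s - t) by rewrite mulr_ge0//; lra.
  by rewrite -[leRHS]mulr1 ler_wpM2l// -expR0 ler_expR oppr_le0 mulr_ge0//; lra.
have {}tT : 0 <= t <= T by lra.
have [d d0 dP] := within_cvgP (has_deriv_within_cvg (deriv t tT)) e0.
exists d => // s s0 std.
have sd : `|s - t| < d by rewrite ltr0_norm; lra.
have := dP s (in0T s ltac:(lra)) sd; rewrite /h.
set u := x s - y s; set v := x t - y t => uv.
have vu : `|v| <= `|u| + e.
  rewrite -[v](subrK u) (le_trans (ler_normD _ _))// addrC lerD2l distrC.
  exact: ltW.
apply: le_trans (ler_wpM2r (expR_ge0 _) vu) _; rewrite mulrDl lerD//.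
  by rewrite ler_wpM2l// ler_expR lerN2 ler_wpM2l//; lra.
rewrite -[leRHS]mulr1 (ler_wpM2l (ltW e0))// -expR0 ler_expR oppr_le0.
by rewrite mulr_ge0//; lra.
Qed.

Lemma solution_bounded f x a b : is_solution f `[a, b] x ->
  exists r, forall t, a <= t <= b -> `|x t| <= r.
Proof.
move=> xs.
have /compact_bounded : compact (x @` `[a, b]).
  apply: continuous_compact; last exact: segment_compact.
  apply/subspace_continuousP => t tab.
  by move/is_solutionP : xs => /(_ t tab); exact: has_deriv_within_cvg.
move=> [M [Mreal MP]]; exists (M + 1) => t tab.
by apply: MP; [rewrite ltrDl|exists t => //; rewrite /= in_itv].
Qed.

Lemma solution_unique_ge0 f x y T : lipschitz_on_balls f -> 0 <= T ->
  is_solution f `[0, T] x -> is_solution f `[0, T] y -> x 0 = y 0 -> x T = y T.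
Proof.
move=> flip T0 xs ys; have [r xr] := solution_bounded xs.
have [r' yr] := solution_bounded ys.
apply: (gronwall_unique T0 (flip (Num.max r r'))) => // t tT /=.
by rewrite !le_max xr// yr// orbT.
Qed.

Lemma is_solution_opp f J x : is_solution f J x ->
  is_solution (fun p => - f p) [set t | J (- t)] (x \o -%R).
Proof.
by move=> /is_solutionP xs; apply/is_solutionP => t /xs/has_deriv_within_opp.
Qed.

Lemma lipschitz_on_ballsN f : lipschitz_on_balls f ->
  lipschitz_on_balls (fun p => - f p).
Proof.
move=> flip r; have [L L0 fL] := flip r; exists L => // p q pr qr.
by rewrite -opprD normrN fL.
Qed.

Lemma solution_unique f J x : lipschitz_on_balls f -> is_solution f J x ->
  is_unique_solution f J (x 0) x.
Proof.
move=> flip xs; split => // I y iI I0 IJ ys yx0 t It.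
have [t0|/ltW t0] := leP 0 t.
  have tI : `[0, t] `<=` I by move=> s; rewrite /= in_itv/=; exact: iI.
  apply: (solution_unique_ge0 flip t0) => //; first exact: is_solutionW ys.
  by apply: is_solutionW xs; exact: subset_trans IJ.
(* Negative times reduce to positive ones by reversing time, which turns the field into [- f]. *)
have tI : `[0, (- t)] `<=` [set s | I (- s)].
  move=> s; rewrite /= in_itv/= => st; apply: (iI t 0) => //; lra.
rewrite -[t]opprK.
apply: (@solution_unique_ge0 _ (y \o -%R) (x \o -%R) _
  (lipschitz_on_ballsN flip)) => /=.
- by lra.
- by apply: is_solutionW (is_solution_opp ys).
- apply: is_solutionW (is_solution_opp xs) => s /tI; exact: IJ.
- by rewrite oppr0.
Qed.

End uniqueness.

Section existence.
Context (R : realType) (n : nat) (f : 'cV[R]_n -> 'cV[R]_n) (L B : R).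
Context (L0 : 0 <= L) (B0 : 0 <= B).
Context (fL : forall p q, `|f p - f q| <= L * `|p - q|).
Context (fB : forall p, `|f p| <= B) (x0 : 'cV[R]_n).

Let euler (h : R) k : 'cV[R]_n := iter k (fun p : 'cV[R]_n => p + h *: f p) x0.

Let euler_speed h k j : 0 <= h ->
  `|euler h (k + j) - euler h k| <= j%:R * h * B.
Proof.
move=> h0; elim: j => [|j IH]; first by rewrite addn0 subrr normr0 !mul0r.
rewrite addnS /= addrAC (le_trans (ler_normD _ _))// -natr1 !mulrDl mul1r.
by rewrite lerD// normrZ ger0_norm// ler_wpM2l.
Qed.

(** Each step adds at most [h * L * (j * h * B)], and [z ^+ 2 + h * z <= (z + h) ^+ 2] with
    [z = j * h] closes the induction. *)
Let euler_quadratic h k j : 0 <= h ->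
  `|euler h (k + j) - euler h k - (j%:R * h) *: f (euler h k)| <=
  L * B * (j%:R * h) ^+ 2.
Proof.
move=> h0; elim: j => [|j IH].
  by rewrite addn0 mul0r subrr scale0r subrr normr0 expr0n/= mulr0.
rewrite addnS /=; set p := euler h (k + j) in IH *; set q := euler h k in IH *.
have -> : p + h *: f p - q - (j.+1%:R * h) *: f q =
    (p - q - (j%:R * h) *: f q) + h *: (f p - f q).
  rewrite -natr1 mulrDl mul1r scalerDl scalerBr [p + _ - q]addrAC opprD.
  by rewrite addrACA.
apply: le_trans (ler_normD _ _) _; rewrite normrZ ger0_norm//.
have fpq : `|f p - f q| <= L * (j%:R * h * B).
  by apply: le_trans (fL _ _) _; rewrite ler_wpM2l//; exact: euler_speed.
apply: le_trans (lerD IH (ler_wpM2l h0 fpq)) _.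
have -> : h * (L * (j%:R * h * B)) = L * B * (h * (j%:R * h)) by ring.
rewrite -mulrDr ler_wpM2l ?mulr_ge0// -natr1 mulrDl mul1r.
have : 0 <= j%:R * h by rewrite mulr_ge0.
by move: (j%:R * h) => z z0; nra.
Qed.

(** Euler schemes with step [1 / (i + 1)] satisfy the quadratic estimate up to the step size, so
    their ultrafilter limit solves the equation. *)
Lemma bounded_lipschitz_solution_exists :
  exists2 x, is_solution f `[0, +oo[ x & x 0 = x0.
Proof.
pose h (i : nat) : R := i.+1%:R^-1.
have h0 i : 0 < h i by rewrite invr_gt0.
have h00 i : 0 <= h i by exact: ltW.
(* The number of whole steps made before [t]. Thus [X i] is piecewise constant, holding the value of
   the last node. *)
pose N i (t : R) := Num.truncn (t * i.+1%:R).
pose X i t : 'cV[R]_n := euler (h i) (N i t).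
have NP i t : 0 <= t -> (N i t)%:R * h i <= t < (N i t)%:R * h i + h i.
  move=> t0; have ti : 0 <= t * i.+1%:R by rewrite mulr_ge0.
  rewrite -[X in _ < _ + X]mul1r -mulrDl natr1 /h ler_pdivrMr// ltr_pdivlMr//.
  exact: truncn_itv.
(* The elapsed grid time [z] differs from [s - t] by at most one step, hence the corrections in
   [h i]. *)
have est i s t : 0 <= t -> t <= s ->
    `|X i s - X i t| <= B * (s - t + h i) /\
    `|X i s - X i t - (s - t) *: f (X i t)| <=
      L * B * (s - t + h i) ^+ 2 + B * h i.
  move=> t0 ts; have s0 : 0 <= s by lra.
  have Nts : (N i t <= N i s)%N by rewrite /N le_truncn// ler_wpM2r.
  have := NP i t t0; have := NP i s s0.
  rewrite /X -(subnKC Nts) natrD mulrDl; set j := (N i s - N i t)%N.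
  have jh0 : 0 <= j%:R * h i by rewrite mulr_ge0.
  have := euler_quadratic (N i t) j (h00 i).
  have := euler_speed (N i t) j (h00 i).
  set p := euler _ (_ + _); set q := euler _ _.
  move: (j%:R * h i) jh0 ((N i t)%:R * h i) => z z0 w pq pqf Ns Nt.
  have zst : z <= s - t + h i by lra.
  split; first by apply: le_trans pq _; rewrite mulrC ler_wpM2l.
  have -> : p - q - (s - t) *: f q = p - q - z *: f q + (z - (s - t)) *: f q.
    by rewrite [in RHS]scalerBl [RHS]addrA subrK.
  apply: le_trans (ler_normD _ _) _; apply: lerD.
    apply: le_trans pqf _; rewrite ler_wpM2l ?mulr_ge0//.
    by rewrite lerXn2r ?nnegrE//; lra.
  have zh : `|z - (s - t)| <= h i by rewrite ler_norml; lra.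
  by rewrite normrZ mulrC ler_pM.
have far i t : 0 <= t -> `|X i t - x0| <= B * (t + 1).
  move=> t0; have [+ _] := est i t 0 (lexx 0) t0; rewrite subr0.
  have -> : X i 0 = x0 by rewrite /X /N mul0r truncn0.
  move=> /le_trans; apply; rewrite ler_wpM2l// lerD2l /h invf_le1//.
  by rewrite ler1n.
have [U [UU ooU]] := ultraFilterLemma (eventually_filter).
have lim (t : R) : exists p : 'cV[R]_n, 0 <= t -> X i t @[i --> U] --> p.
  have [t0|t0] := leP 0 t; last by exists 0.
  have UX : U ((fun i => X i t) @^-1` [set p | `|p - x0| <= B * (t + 1)]).
    by apply: filterE => i /=; exact: far.
  have [p _ Xp] := ultra_cvg_compact UU (@closed_ball_compact _ _ _ _) UX.
  by exists p.
have [x Xx] := choice lim.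
exists x; last first.
  have X0 : X i 0 @[i --> U] --> x0.
    have -> : X ^~ 0 = cst x0 by apply/funext => i; rewrite /X /N mul0r truncn0.
    exact: cvg_cst.
  exact: (cvg_unique (@norm_hausdorff _ _) (Xx 0 (lexx 0)) X0).
(* One [L * B] is the quadratic estimate, the second pays for moving the base point when [s < t],
   and [B] pays for rounding to the grid. *)
pose C := 2 * (L * B) + B.
have LB0 : 0 <= L * B by exact: mulr_ge0.
have B0' := B0.
have C0 : 0 <= C by rewrite addr_ge0// mulr_ge0.
apply: (@solution_limit _ _ _ nat U _ _ X x C h) => //.
- apply: lipschitz_on_balls_continuous => r; exists L => // p q _ _; exact: fL.
- by move=> t; rewrite /= in_itv/= andbT; exact: Xx.
- apply: cvg_trans (@cvg_harmonic R); exact: cvg_app.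
move=> s t; rewrite /= !in_itv/= !andbT => s0 t0; apply: filterE => i.
have [ts|/ltW st] := leP t s.
  rewrite ger0_norm ?subr_ge0//; have [_ /le_trans] := est i s t t0 ts; apply.
  have := sqr_ge0 (s - t + h i); have := h00 i; rewrite /C.
  by move: ((_ + _) ^+ 2) => z; nra.
have [Xst quad] := est i t s s0 st.
(* The estimate is known with the earlier time as base point; exchanging base points costs the
   difference of the two velocities. *)
have -> : X i s - X i t - (s - t) *: f (X i t) =
    (t - s) *: (f (X i t) - f (X i s)) - (X i t - X i s - (t - s) *: f (X i s)).
  by rewrite -[s - t]opprB scaleNr opprK scalerBr !opprB subrKA addrC.
rewrite [`|s - t|]distrC ger0_norm ?subr_ge0//.
apply: le_trans (ler_normB _ _) _; rewrite normrZ ger0_norm ?subr_ge0//.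
have fX : `|f (X i t) - f (X i s)| <= L * (B * (t - s + h i)).
  by apply: le_trans (fL _ _) _; rewrite ler_wpM2l.
have ts0 : 0 <= t - s by lra.
apply: le_trans (lerD (ler_wpM2l ts0 fX) quad) _.
have := h00 i; move: (h i) => z z0; rewrite /C.
move: (t - s) ts0 => u u0.
have -> : u * (L * (B * (u + z))) = L * B * (u * (u + z)) by ring.
have uz : L * B * (u * (u + z)) <= L * B * (u + z) ^+ 2.
  by rewrite ler_wpM2l//; nra.
have Bz : 0 <= B * (u + z) ^+ 2 by rewrite mulr_ge0// sqr_ge0.
have LBz : 0 <= L * B * z by rewrite mulr_ge0.
by move: uz Bz LBz; rewrite !mulrDl; lra.
Qed.
End existence.

(** * Truncation of the field and global solutions in a compact set *)

(** The coordinatewise projection onto the ball of the sup norm, which is 1-Lipschitz for that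
    norm. *)
Definition clamp (R : realType) m n (r : R) (p : 'M[R]_(m, n)) : 'M[R]_(m, n) :=
  \matrix_(i, j) Num.max (- r) (Num.min r (p i j)).

Lemma clamp_le (R : realType) m n (r : R) (p : 'M[R]_(m, n)) :
  0 <= r -> `|clamp r p| <= r.
Proof.
move=> r0; apply: norm_le_entry => // i j; rewrite mxE ler_norml.
by rewrite le_max lexx ge_max ge_min lexx andbT; lra.
Qed.

Lemma clamp_id (R : realType) m n (r : R) (p : 'M[R]_(m, n)) :
  `|p| <= r -> clamp r p = p.
Proof.
move=> pr; apply/matrixP => i j; rewrite mxE.
have := le_trans (entry_le_norm p i j) pr; rewrite ler_norml => /andP[rp pr'].
by rewrite min_r// max_r.
Qed.

Lemma minmax_lipschitz (R : realType) (r u v : R) :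
  `|Num.max (- r) (Num.min r u) - Num.max (- r) (Num.min r v)| <= `|u - v|.
Proof.
have [d1 d2] : - `|u - v| <= u - v /\ u - v <= `|u - v|.
  by apply/andP; rewrite -ler_norml.
move: `|u - v| d1 d2 => d d1 d2; rewrite ler_norml.
by case: (leP r u); case: (leP r v); case: (leP (- r) r);
   case: (leP (- r) u); case: (leP (- r) v) => *; lra.
Qed.

Lemma clamp_lipschitz (R : realType) m n (r : R) (p q : 'M[R]_(m, n)) :
  `|clamp r p - clamp r q| <= `|p - q|.
Proof.
apply: norm_le_entry => // i j; rewrite !mxE.
apply: le_trans (minmax_lipschitz _ _ _) _.
by have := entry_le_norm (p - q) i j; rewrite !mxE.
Qed.

Section confinement.
Context (R : realType) (n : nat).
Implicit Types (f : 'cV[R]_n -> 'cV[R]_n) (x : R -> 'cV[R]_n) (K : set 'cV[R]_n).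

Lemma compact_norm_le K : compact K -> exists2 r, 0 <= r &
  forall p, K p -> `|p| <= r.
Proof.
move=> /compact_bounded [M [_ MP]]; exists (Num.max 0 (M + 1)) => [|p Kp].
  by rewrite le_max lexx.
by rewrite le_max (MP (M + 1)) ?orbT// ltrDl.
Qed.

Lemma solution_eq_field f g J x : (forall t, J t -> f (x t) = g (x t)) ->
  is_solution g J x -> is_solution f J x.
Proof. by move=> fg + t Jt => /(_ t Jt); rewrite fg. Qed.

(* The a priori bound makes it possible to truncate the field outside a ball,
   so that no maximal interval of existence needs to be considered. *)
Lemma confined_solution_exists f K (x0 : 'cV[R]_n) :
  lipschitz_on_balls f -> compact K -> K x0 ->
  (forall x T, 0 <= T -> is_solution f `[0, T] x -> x 0 = x0 -> K (x T)) ->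
  exists x, [/\ is_solution f `[0, +oo[ x, x 0 = x0 & forall t, 0 <= t -> K (x t)].
Proof.
move=> flip cK Kx0 apriori; have [r r0 Kr] := compact_norm_le cK.
(* The margin 1 beyond the radius of [K] lets the solution move a little before it is known to be in
   [K] again. *)
have r10 : 0 <= r + 1 by lra.
have [L L0 fL] := flip (r + 1).
pose g p := f (clamp (r + 1) p).
have gL p q : `|g p - g q| <= L * `|p - q|.
  apply: le_trans (fL _ _ (clamp_le _ r10) (clamp_le _ r10)) _.
  by rewrite ler_wpM2l// clamp_lipschitz.
have gB p : `|g p| <= `|f 0| + L * (r + 1).
  rewrite -[g p](subrK (f 0)) (le_trans (ler_normD _ _))// addrC lerD2l.
  apply: le_trans (fL _ _ (clamp_le _ r10) _) _; first by rewrite /= normr0.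
  by rewrite subr0 ler_wpM2l// clamp_le.
have B0 : 0 <= `|f 0| + L * (r + 1) by rewrite addr_ge0// mulr_ge0.
have [x xg xx0] := bounded_lipschitz_solution_exists L0 B0 gL gB x0.
(* While it stays in the larger ball, the solution of the truncated field solves the original
   equation, so the a priori bound applies. *)
have xK T : 0 <= T -> (forall t, 0 <= t <= T -> `|x t| <= r + 1) -> K (x T).
  move=> T0 xr; apply: apriori => //.
  apply: (@solution_eq_field _ g) => [t|].
    by rewrite /= in_itv/= => /xr tr; rewrite /g clamp_id.
  by apply: is_solutionW xg => t; rewrite /= !in_itv/= andbT => /andP[].
have near1 t : 0 <= t -> exists2 d, 0 < d & forall s, 0 <= s -> `|s - t| < d ->
    `|x s - x t| < 1.
  move=> t0; have [|d d0 dP] := @solution_cvg _ _ _ _ _ t xg _ 1 ltr01.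
    by rewrite /= in_itv/= t0.
  by exists d => // s s0; apply: dP; rewrite /= in_itv/= s0.
(* By continuity, from a point of [K] the solution stays in the larger ball for a while, and [xK]
   brings it back to [K]. *)
have xKall : forall t, 0 <= t -> K (x t).
  apply: real_induction; first by rewrite xx0.
    move=> t t0 tK; have [d d0 dP] := near1 t t0; exists d => // s std.
    apply: xK => [|u us]; first by lra.
    have [ut|tu] := leP u t; first by apply: le_trans (Kr _ (tK u _)) _; lra.
    have xut : `|x u - x t| < 1 by apply: dP; rewrite ?gtr0_norm; lra.
    have := Kr _ (tK t ltac:(lra)).
    rewrite -[x u](subrK (x t)) => xtr; rewrite (le_trans (ler_normD _ _))//; lra.
  move=> t t0 tK; apply: xK => [|u ut]; first exact: ltW.
  have [ult|tu] := ltP u t; first by apply: le_trans (Kr _ (tK u _)) _; lra.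
  have -> : u = t by lra.
  have [d d0 dP] := near1 t (ltW t0).
  pose s := Num.max 0 (t - d / 2).
  have s0 : 0 <= s by rewrite le_max lexx.
  have st : s < t by rewrite gt_max t0; lra.
  have ds : t - d < s by rewrite lt_max; apply/orP; right; lra.
  have xst : `|x s - x t| < 1 by apply: dP; rewrite ?ltr0_norm; lra.
  have := Kr _ (tK s ltac:(lra)).
  rewrite -[x t](subrK (x s)) => xsr; rewrite (le_trans (ler_normD _ _))//.
  by rewrite distrC; lra.
exists x; split => //; apply: (@solution_eq_field _ g) => // t.
rewrite /= in_itv/= andbT => /xKall/Kr xr; rewrite /g clamp_id//; lra.
Qed.

End confinement.

(** * Positive limit sets *)

Section limit_set.
Context (R : realType) (n : nat).
Implicit Types (f : 'cV[R]_n -> 'cV[R]_n) (x : R -> 'cV[R]_n).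
Implicit Types (K C : set 'cV[R]_n).

Lemma positive_limit_setP x (p : 'cV[R]_n) : positive_limit_set x p <->
  forall e T, 0 < e -> exists2 t, T <= t & `|x t - p| < e.
Proof.
split=> [[t [toy tp]] e T e0|xp].
  have late : \forall i \near \oo, T <= t i by move/cvgryPge : toy; exact.
  have close : \forall i \near \oo, `|p - x (t i)| < e.
    by move/cvgrPdist_lt: tp; exact.
  have [i [/= Ti ip]] := filter_ex (filterI late close).
  by exists (t i) => //; rewrite distrC.
have ex i : exists t : R, i%:R <= t /\ `|x t - p| < i.+1%:R^-1.
  by have [|t] := xp i.+1%:R^-1 i%:R; [rewrite invr_gt0|exists t].
have [t tP] := choice ex; exists t; split.
  apply/cvgryPge => A; have := nbhs_infty_ger A; apply: filterS => i /= Ai.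
  by apply: le_trans Ai _; have [] := tP i.
apply/cvgrPdist_lt => e e0.
have : \forall i \near \oo, `|0 - i.+1%:R^-1| < e :> R.
  by move: e e0; apply/cvgrPdist_lt; exact: cvg_harmonic.
apply: filterS => i /= ie; rewrite distrC.
have [_ /lt_trans] := tP i; apply.
by rewrite sub0r normrN ger0_norm in ie.
Qed.

(** Any cluster point of [x] along such late times will do. Besides non-emptiness, this lemma serves
    to refute recurrent behaviour: a bad closed set visited forever would contain a limit point. *)
Lemma late_limit_point x K C : compact K -> (forall t, 0 <= t -> K (x t)) ->
  closed C -> (forall T, exists2 t, T <= t & C (x t)) ->
  exists2 p, positive_limit_set x p & K p /\ C p.
Proof.
move=> cK xK cC xC.
have ex i : exists t : R, i%:R <= t /\ C (x t).
  by have [t] := xC i%:R; exists t.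
have [t tP] := choice ex.
have KC : \forall i \near \oo, (K `&` C) (x (t i)).
  apply: filterE => i; have [it Ct] := tP i; split => //=.
  by apply: xK; apply: le_trans it.
have [p [[Kp Cp] pcl]] :=
  compact_closedI cK cC (fmap_proper_filter (x \o t) eventually_filter) KC.
exists p => //; apply/positive_limit_setP => e T e0.
have late : \forall i \near \oo, [set q | exists2 s, T <= s & q = x s] (x (t i)).
  have := nbhs_infty_ger T; apply: filterS => i /= Ti.
  by exists (t i) => //; apply: le_trans Ti _; have [] := tP i.
have [_ [[s Ts ->] xsp]] := pcl _ _ late (nbhsx_ballx p e e0).
by exists s => //; move: xsp; rewrite -ball_normE/= distrC.
Qed.

Lemma positive_limit_set_closed x : closed (positive_limit_set x).
Proof.
move=> p pcl; apply/positive_limit_setP => e T e0.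
have e20 : 0 < e / 2 by lra.
have [q [/positive_limit_setP/(_ _ T e20)[t Tt xtq]]] := pcl _ (nbhsx_ballx p _ e20).
rewrite -ball_normE/= => pq; exists t => //.
rewrite distrC in pq.
by rewrite -[x t - p](subrKA q) (le_lt_trans (ler_normD _ _))//; lra.
Qed.

Lemma positive_limit_set_sub x K : closed K -> (forall t, 0 <= t -> K (x t)) ->
  positive_limit_set x `<=` K.
Proof.
move=> cK xK p /positive_limit_setP px; apply: cK => A /nbhs_ballP[e e0 eA].
have [t t0 xtp] := px e 0 e0; exists (x t); split; first exact: xK.
by apply: eA; rewrite -ball_normE/= distrC.
Qed.

(** After each visit near [q] there is a later visit near [p], so [G p <= G q]; the roles are
    symmetric. *)
Lemma limit_set_monotone_const x (G : 'cV[R]_n -> R) T (p q : 'cV[R]_n) :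
  continuous G ->
  (forall s t, T <= s -> s <= t -> G (x t) <= G (x s)) ->
  positive_limit_set x p -> positive_limit_set x q -> G p = G q.
Proof.
move=> Gc Gx.
suff le p' q' : positive_limit_set x p' -> positive_limit_set x q' -> G p' <= G q'.
  by move=> px qx; apply/eqP; rewrite eq_le !le.
move=> /positive_limit_setP px /positive_limit_setP qx.
apply/ler_addgt0Pr => e e0; have e20 : 0 < e / 2 by lra.
have [d d0 dP] := (continuous_at_normP _ _).1 (Gc p') _ e20.
have [d' d'0 d'P] := (continuous_at_normP _ _).1 (Gc q') _ e20.
have [s Ts xsq] := qx d' T d'0; have [t st xtp] := px d s d0.
have := Gx s t Ts st; have := dP _ xtp; have := d'P _ xsq.
by rewrite !ltr_norml => /andP[? ?] /andP[? ?]; lra.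
Qed.

(** The shifts [x (t i + s)] converge along one ultrafilter for every real [s], since [t i + s] is
    eventually nonnegative. Each limit value is itself approached at arbitrarily late times. *)
Lemma limit_set_orbit f x K (p : 'cV[R]_n) : lipschitz_on_balls f -> compact K ->
  is_solution f `[0, +oo[ x -> (forall t, 0 <= t -> K (x t)) ->
  positive_limit_set x p ->
  exists y, [/\ is_solution f setT y, y 0 = p &
    forall t, positive_limit_set x (y t)].
Proof.
move=> flip cK xs xK [t [toy tp]].
have [r r0 Kr] := compact_norm_le cK; have [L L0 fL] := flip r.
pose B := `|f 0| + L * r.
have fB q : K q -> `|f q| <= B.
  move=> /Kr qr; rewrite -[f q](subrK (f 0)) (le_trans (ler_normD _ _))//.
  rewrite addrC lerD2l; apply: le_trans (fL _ _ qr _) _ => /=; rewrite ?normr0//.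
  by rewrite subr0 ler_wpM2l.
have B0 : 0 <= B by rewrite addr_ge0// mulr_ge0.
have [U [UU ooU]] := ultraFilterLemma eventually_filter.
have lateU (s T : R) : U [set i | T <= t i + s].
  apply: ooU; have /cvgryPge/(_ (T - s)) := toy; apply: filterS => i /=; lra.
have lim (s : R) : exists q : 'cV[R]_n, x (t i + s) @[i --> U] --> q.
  have UK : U ((fun i => x (t i + s)) @^-1` K).
    by have := lateU s 0; apply: filterS => i /=; exact: xK.
  by have [q _ xq] := ultra_cvg_compact UU cK UK; exists q.
have [y yP] := choice lim.
exists y; split.
(* Shifted solutions are exact, so the error term is 0. *)
- apply: (@solution_limit _ _ _ nat U _ _ (fun i s => x (t i + s)) y (L * B)
    (cst 0)) => //.
  + exact: lipschitz_on_balls_continuous.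
  + by rewrite mulr_ge0.
  + exact: cvg_cst.
  move=> s u _ _; have := lateU s 0; have := lateU u 0.
  apply: filterS2 => i /= u0 s0; rewrite addr0 mulr0 addr0.
  have -> : s - u = (t i + s) - (t i + u) by lra.
  have fLK q q' : K q -> K q' -> `|f q - f q'| <= L * `|q - q'|.
    by move=> /Kr ? /Kr ?; exact: fL.
  apply: (solution_quadratic L0 _ xs _ fB fLK); rewrite /= ?in_itv/= ?andbT//.
  + exact: interval_is_interval.
  + by move=> w; rewrite /= in_itv/= andbT; exact: xK.
- apply: (cvg_unique (@norm_hausdorff _ _) (yP 0)).
  have -> : (fun i => x (t i + 0)) = x \o t by apply/funext => i; rewrite addr0.
  exact: cvg_trans (cvg_app _ ooU) tp.
move=> s; apply/positive_limit_setP => e T e0.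
have near_y : U [set i | `|y s - x (t i + s)| < e].
  by move/cvgrPdist_lt : (yP s); exact.
have [i [/= Ti ie]] := filter_ex (filterI (lateU s T) near_y).
by exists (t i + s) => //; rewrite distrC.
Qed.

Lemma limit_set_invariant f x K : lipschitz_on_balls f -> compact K ->
  is_solution f `[0, +oo[ x -> (forall t, 0 <= t -> K (x t)) ->
  flow_invariant f (positive_limit_set x).
Proof.
move=> flip cK xs xK p /(limit_set_orbit flip cK xs xK)[y [ys <- yp]].
by exists y; split => //; exact: solution_unique.
Qed.

(** Disjoint compact sets lie at positive distance, which gives a uniform separation and hence a
    Urysohn function. *)
Lemma disjoint_compact_separated (A B : set 'cV[R]_n) : compact A -> compact B ->
  A `&` B = set0 -> exists g : 'cV[R]_n -> R,
  [/\ continuous g, forall p, A p -> g p = 0 & forall p, B p -> g p = 1].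
Proof.
move=> cA cB AB.
have [e e0 sep] : exists2 e : R, 0 < e & forall p q, A p -> B q -> e <= `|p - q|.
  have : \forall e \near (0 : R)^'+, A `*` B `<=`
      (fun p : 'cV[R]_n * 'cV[R]_n => e <= `|p.1 - p.2|).
    move/compact_near_coveringP : (compact_setX cA cB); apply => -[p q] [/= Ap Bq].
    have pq0 : 0 < `|p - q|.
      rewrite normr_gt0 subr_eq0; apply/eqP => pq.
      have : (A `&` B) p by split=> //; rewrite pq.
      by rewrite AB.
    (* Moving both points by less than a quarter of their distance leaves more than half of it. *)
    have pq40 : 0 < `|p - q| / 4 by lra.
    exists (ball p (`|p - q| / 4) `*` ball q (`|p - q| / 4),
            [set e | e < `|p - q| / 4]).
      split=> /=; last exact: nbhs_right_lt pq40.
      by exists (ball p (`|p - q| / 4), ball q (`|p - q| / 4)) => //=;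
        split; exact: nbhsx_ballx.
    move=> [[u v] e] /=; rewrite -!ball_normE/= => -[[pu qv] epq].
    have : `|p - q| <= `|p - u| + `|u - v| + `|q - v|.
      rewrite [`|q - v|]distrC -[p - q](subrKA u) -[u - q](subrKA v).
      by rewrite addrA (le_trans (ler_normD _ _))// lerD2r ler_normD.
    lra.
  move=> ABe; have [e [/= eP e0]] := filter_ex (filterI ABe (nbhs_right_gt 0)).
  by exists e => // p q Ap Bq; exact: (eP (p, q)).
have /(@uniform_separatorP _ R)[g [gc _ g0 g1]] : uniform_separator A B.
  apply: uniform_separatorW.
  exists [set pq : 'cV[R]_n * 'cV[R]_n | ball pq.1 e pq.2].
    by rewrite -entourage_ballE; exists e.
  rewrite -subset0 => -[p q] /= [[Ap Bq]]; rewrite -ball_normE/= => pqe.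
  by have := sep p q Ap Bq; rewrite leNgt pqe.
by exists g; split => // p ?; [apply: g0|apply: g1]; exists p.
Qed.

(** If [A] and its complement in the limit set were both non-empty, the trajectory would pass
    between them forever. A separating function would take the value 1/2 at arbitrarily late times,
    hence at a limit point lying in neither piece. *)
Lemma limit_set_connected f x K : compact K -> is_solution f `[0, +oo[ x ->
  (forall t, 0 <= t -> K (x t)) -> connected (positive_limit_set x).
Proof.
move=> cK xs xK A [p0 Ap0] [C1 oC1 AE1] [C2 cC2 AE2].
set W := positive_limit_set x in AE1 AE2 *.
have cW : compact W.
  apply: (subclosed_compact (@positive_limit_set_closed x) cK).
  by apply: positive_limit_set_sub xK; exact: compact_closed (@norm_hausdorff _ _) cK.
have cA : compact A by rewrite AE2; exact: compact_closedI.
have cB : compact (W `&` ~` C1).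
  by apply: compact_closedI => //; exact: open_closedC.
apply: contrapT => AW.
have [q0 [Wq0 C1q0]] : W `&` ~` C1 !=set0.
  apply: contrapT => /set0P/negP/negPn/eqP WC1; apply: AW.
  rewrite AE1 eqEsubset; split=> [p []//|p Wp]; split=> //.
  apply: contrapT => nC1p; have : (W `&` ~` C1) p by [].
  by rewrite WC1.
have AB : A `&` (W `&` ~` C1) = set0.
  by rewrite -subset0 => p [+ [_ nC1p]]; rewrite AE1 => -[].
have [g [gc g0 g1]] := disjoint_compact_separated cA cB AB.
have Wp0 : W p0 by move: Ap0; rewrite AE1 => -[].
have half T : exists2 t, T <= t & g (x t) = 2^-1.
  (* Within 1/3 of the values 0 and 1, [g] lies on opposite sides of 1/2, as the intermediate value
     theorem requires. *)
  have h0 : 0 < 3^-1 :> R by lra.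
  have [d d0 dP] := (continuous_at_normP _ _).1 (gc p0) _ h0.
  have [d' d'0 d'P] := (continuous_at_normP _ _).1 (gc q0) _ h0.
  rewrite g0// in dP; rewrite g1// in d'P.
  have [s Ts /dP xsp] := (positive_limit_setP x p0).1 Wp0 d (Num.max 0 T) d0.
  have [t st /d'P xtq] := (positive_limit_setP x q0).1 Wq0 d' s d'0.
  move: Ts; rewrite ge_max => /andP[s0 Ts].
  have xc : {within `[s, t], continuous (g \o x)}.
    apply/subspace_continuousP => u; rewrite /= in_itv/= => /andP[su ut].
    apply: (@cvg_comp _ _ _ x g _ (nbhs (x u))); last exact: gc.
    have u0 : `[0, +oo[%classic u by rewrite /= in_itv/= andbT; lra.
    move/is_solutionP : xs => /(_ u u0)/has_deriv_within_cvg; apply: cvg_trans.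
    apply: cvg_app; apply: within_subset => v /=; rewrite !in_itv/= andbT; lra.
  have [|c] := IVT st xc (v := 2^-1).
    rewrite ge_min le_max /=; move: xsp xtq; rewrite !ltr_norml; lra.
  by rewrite in_itv/= => /andP[sc _] gc2; exists c => //; lra.
have cC : closed [set p | g p = 2^-1].
  by apply: (@closed_comp _ _ g [set r | r = 2^-1]) => [p _|];
    [exact: gc|exact: closed_eq].
have [p Wp [_ /= gp]] := late_limit_point cK xK cC half.
have [C1p|nC1p] := pselect (C1 p).
  have : A p by rewrite AE1.
  by move=> /g0; rewrite gp; lra.
by have /g1 : (W `&` ~` C1) p by []; rewrite gp; lra.
Qed.

End limit_set.

(** * The closed-loop field *)

Lemma lipschitz_on_balls_bounded (R : realType) (V W : normedModType R)
    (g : V -> W) r : lipschitz_on_balls g ->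
  exists2 B, 0 <= B & forall p, `|p| <= r -> `|g p| <= B.
Proof.
move=> glip; have [L L0 gL] := glip (Num.max 0 r).
exists (`|g 0| + L * Num.max 0 r) => [|p pr].
  by rewrite addr_ge0// mulr_ge0// le_max lexx.
rewrite -[g p](subrK (g 0)) (le_trans (ler_normD _ _))// addrC lerD2l.
apply: le_trans (gL _ _ _ _) _ => /=; rewrite ?normr0 ?le_max ?pr ?lexx ?orbT//.
by rewrite subr0 ler_wpM2l// le_max pr orbT.
Qed.

Section lipschitz_algebra.
Context (R : realType) (V W : normedModType R).

Lemma lipschitz_on_ballsB (g h : V -> W) : lipschitz_on_balls g ->
  lipschitz_on_balls h -> lipschitz_on_balls (fun p => g p - h p).
Proof.
move=> glip hlip r; have [L L0 gL] := glip r; have [M M0 hM] := hlip r.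
exists (L + M) => [|p q pr qr]; first exact: addr_ge0.
have -> : g p - h p - (g q - h q) = (g p - g q) - (h p - h q).
  by rewrite !opprD !opprK addrACA.
by rewrite (le_trans (ler_normB _ _))// mulrDl lerD ?gL ?hM.
Qed.

Lemma lipschitz_on_ballsZ (k : V -> R) (g : V -> W) : lipschitz_on_balls k ->
  lipschitz_on_balls g -> lipschitz_on_balls (fun p => k p *: g p).
Proof.
move=> klip glip r; have [L L0 kL] := klip r; have [M M0 gM] := glip r.
have [A A0 kA] := lipschitz_on_balls_bounded r klip.
have [B B0 gB] := lipschitz_on_balls_bounded r glip.
exists (A * M + L * B) => [|p q pr qr]; first by rewrite addr_ge0// mulr_ge0.
have -> : k p *: g p - k q *: g q = k p *: (g p - g q) + (k p - k q) *: g q.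
  by rewrite scalerBr scalerBl subrKA.
rewrite (le_trans (ler_normD _ _))// mulrDl !normrZ lerD//.
  by rewrite -mulrA ler_pM// ?kA ?gM.
by rewrite mulrAC ler_pM// ?kL ?gB.
Qed.

End lipschitz_algebra.

Lemma lipschitz_on_balls_sum (R : realType) (V W : normedModType R) (I : finType)
    (g : I -> V -> W) : (forall i, lipschitz_on_balls (g i)) ->
  lipschitz_on_balls (fun p => \sum_i g i p).
Proof.
move=> glip r; have ex i : exists L, 0 <= L /\ forall p q, `|p| <= r ->
    `|q| <= r -> `|g i p - g i q| <= L * `|p - q|.
  by have [L L0 gL] := glip i r; exists L.
have [L LP] := choice ex; exists (\sum_i L i) => [|p q pr qr].
  by apply: sumr_ge0 => i _; have [] := LP i.
rewrite -sumrB (le_trans (ler_norm_sum _ _ _))// mulr_suml.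
by apply: ler_sum => i _; have [_ ->] := LP i.
Qed.

Section lipschitz_matrix.
Context (R : realType) (V : normedModType R).

Lemma lipschitz_on_balls_entry m n (g : V -> 'M[R]_(m, n)) i j :
  lipschitz_on_balls g -> lipschitz_on_balls (fun p => g p i j).
Proof.
move=> glip r; have [L L0 gL] := glip r; exists L => // p q pr qr.
apply: le_trans (gL p q pr qr).
by have := entry_le_norm (g p - g q) i j; rewrite !mxE.
Qed.

Lemma lipschitz_on_balls_matrix m n (g : V -> 'M[R]_(m, n)) :
  (forall i j, lipschitz_on_balls (fun p => g p i j)) -> lipschitz_on_balls g.
Proof.
move=> glip r; have ex (ij : 'I_m * 'I_n) : exists L, 0 <= L /\
    forall p q, `|p| <= r -> `|q| <= r ->
      `|g p ij.1 ij.2 - g q ij.1 ij.2| <= L * `|p - q|.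
  by have [L L0 gL] := glip ij.1 ij.2 r; exists L.
have [L LP] := choice ex.
have L0 i : 0 <= L i by have [] := LP i.
exists (\sum_i L i) => [|p q pr qr]; first exact: sumr_ge0.
apply: norm_le_entry => [|i j]; first by rewrite mulr_ge0// sumr_ge0.
rewrite !mxE; have [_ /(_ p q pr qr) /= /le_trans] := LP (i, j); apply.
by rewrite ler_wpM2r// (bigD1 (i, j))//= lerDl sumr_ge0.
Qed.

Lemma lipschitz_on_balls_tr m n (g : V -> 'M[R]_(m, n)) :
  lipschitz_on_balls g -> lipschitz_on_balls (fun p => (g p)^T).
Proof.
move=> glip; apply: lipschitz_on_balls_matrix => i j.
under eq_fun do rewrite mxE; exact: lipschitz_on_balls_entry.
Qed.

Lemma lipschitz_on_balls_mulmx m n k (g : V -> 'M[R]_(m, n))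
    (h : V -> 'M[R]_(n, k)) : lipschitz_on_balls g -> lipschitz_on_balls h ->
  lipschitz_on_balls (fun p => g p *m h p).
Proof.
move=> glip hlip; apply: lipschitz_on_balls_matrix => i j.
under eq_fun do rewrite mxE; apply: lipschitz_on_balls_sum => l.
by apply: lipschitz_on_ballsZ; exact: lipschitz_on_balls_entry.
Qed.

End lipschitz_matrix.

Lemma locally_lipschitz_on_balls (R : realType) n (W : normedModType R)
    (g : 'cV[R]_n -> W) : locally_lipschitz g -> lipschitz_on_balls g.
Proof.
move=> glip r; apply: locally_lipschitz_compact => //.
have -> : [set p : 'cV[R]_n | `|p| <= r] = [set p | `|p - 0| <= r].
  by apply/seteqP; split => p /=; rewrite subr0.
exact: closed_ball_compact.
Qed.

Section gradient_algebra.
Context (R : realType) (n : nat).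
Implicit Types (u v : 'rV[R]_n).

Lemma sqr_enorm_row u : enorm u ^+ 2 = rcprod u u^T.
Proof.
rewrite /enorm sqr_sqrtr; last first.
  by apply: sumr_ge0 => i _; apply: sumr_ge0 => j _; exact: sqr_ge0.
by rewrite big_ord1 /rcprod mxE; apply: eq_bigr => j _; rewrite mxE expr2.
Qed.

Lemma rcprodB u (w w' : 'cV[R]_n) : rcprod u (w - w') = rcprod u w - rcprod u w'.
Proof. by rewrite /rcprod mulmxBr !mxE. Qed.

Lemma rcprodC u v : rcprod u v^T = rcprod v u^T.
Proof.
by rewrite /rcprod !mxE; apply: eq_bigr => j _; rewrite !mxE mulrC.
Qed.

(** Cauchy-Schwarz, by expanding the squared norm of [B *: u - P *: v]. *)
Lemma rcprod_sqr_le u v : rcprod u v^T ^+ 2 <= enorm u ^+ 2 * enorm v ^+ 2.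
Proof.
have [v0|v0] := eqVneq (rcprod v v^T) 0.
  have -> : v = 0.
    apply/rowP => j; rewrite mxE; apply/eqP; rewrite -sqrf_eq0 eq_le sqr_ge0 andbT.
    rewrite -v0 /rcprod mxE (bigD1 j)//= mxE expr2 lerDl.
    by apply: sumr_ge0 => k _; rewrite mxE -expr2 sqr_ge0.
  by rewrite trmx0 /rcprod mulmx0 mxE expr0n mulr_ge0// sqr_ge0.
have B0 : 0 < rcprod v v^T by rewrite lt_neqAle eq_sym v0 -sqr_enorm_row sqr_ge0.
rewrite !sqr_enorm_row.
set A := rcprod u u^T; set P := rcprod u v^T; set B := rcprod v v^T in B0 *.
have : 0 <= enorm (B *: u - P *: v) ^+ 2 by exact: sqr_ge0.
rewrite sqr_enorm_row.
have -> : (B *: u - P *: v)^T = B *: u^T - P *: v^T.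
  by apply/matrixP => i j; rewrite !mxE.
have -> : rcprod (B *: u - P *: v) (B *: u^T - P *: v^T) =
    B * (A * B - P ^+ 2).
  have dist s t w : rcprod (s *: u - t *: v) w = s * rcprod u w - t * rcprod v w.
    by rewrite /rcprod mulmxBl -!scalemxAl !mxE.
  rewrite dist !rcprodB !rcprodZ -/A -/B -/P (rcprodC v u) -/P; ring.
by rewrite pmulr_rge0// subr_ge0.
Qed.

End gradient_algebra.

Section closed_loop_algebra.
Context (R : realType) (n : nat) (V theta : 'cV[R]_n -> R).
Context (F : 'cV[R]_n -> 'cV[R]_n) (psi1 psi2 sigma : 'cV[R]_n -> R).
Let f := closed_loop_field V theta F psi1 psi2 sigma.

Lemma closed_loop_fieldE x : f x = sigma x *: (psi1 x *: F x
  - psi2 x *: (gradient V x)^T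
  - (enorm (gradient V x) ^+ 2 *: (gradient theta x)^T
     - (rcprod (gradient V x) (gradient theta x)^T) *: (gradient V x)^T)).
Proof.
rewrite /f /closed_loop_field mulmxBl mul_scalar_mx -mulmxA.
by rewrite [gradient V x *m _]mx11_scalar mul_mx_scalar.
Qed.

(** The last term of the field is orthogonal to the gradient of [V] and drops out. *)
Lemma gradient_closed_loop x : rcprod (gradient V x) (f x) =
  sigma x * (psi1 x * rcprod (gradient V x) (F x)
             - psi2 x * enorm (gradient V x) ^+ 2).
Proof.
by rewrite closed_loop_fieldE rcprodZ !rcprodB !rcprodZ sqr_enorm_row; ring.
Qed.

(** This is what the switching function means: its sign is that of the derivative of [theta] along
    the flow. *)
Lemma gradient_theta_closed_loop x : rcprod (gradient theta x) (f x) =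
  sigma x * switching_fun V theta F psi1 psi2 x.
Proof.
rewrite closed_loop_fieldE rcprodZ !rcprodB !rcprodZ /switching_fun.
rewrite real_normK ?num_real// -!sqr_enorm_row (rcprodC (gradient theta x)).
by ring.
Qed.

Lemma closed_loop_lipschitz :
  locally_lipschitz (gradient V) -> locally_lipschitz (gradient theta) ->
  locally_lipschitz F -> locally_lipschitz psi1 -> locally_lipschitz psi2 ->
  locally_lipschitz sigma -> lipschitz_on_balls f.
Proof.
move=> /locally_lipschitz_on_balls Vl /locally_lipschitz_on_balls tl.
move=> /locally_lipschitz_on_balls Fl /locally_lipschitz_on_balls p1l.
move=> /locally_lipschitz_on_balls p2l /locally_lipschitz_on_balls sl.
(* Writing the squared norm as a matrix product removes the square root: only sums and products of
   Lipschitz maps remain. *)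
rewrite (_ : f = fun x => sigma x *: (psi1 x *: F x
  - psi2 x *: (gradient V x)^T
  - ((gradient V x *m (gradient V x)^T) 0 0 *: (gradient theta x)^T
     - (gradient V x *m (gradient theta x)^T) 0 0 *: (gradient V x)^T))); last first.
  by apply/funext => x; rewrite closed_loop_fieldE sqr_enorm_row.
have Vt := lipschitz_on_balls_tr Vl; have tt := lipschitz_on_balls_tr tl.
apply: lipschitz_on_ballsZ => //; apply: lipschitz_on_ballsB.
  by apply: lipschitz_on_ballsB; exact: lipschitz_on_ballsZ.
by apply: lipschitz_on_ballsB; apply: lipschitz_on_ballsZ => //;
  apply: lipschitz_on_balls_entry; exact: lipschitz_on_balls_mulmx.
Qed.

End closed_loop_algebra.

(** * Monotonicity of functions along solutions *)

Section lyapunov.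
Context (R : realType) (n : nat).
Implicit Types (f : 'cV[R]_n -> 'cV[R]_n) (x : R -> 'cV[R]_n) (G : 'cV[R]_n -> R).

(** Continuity of [G] and of the solution supplies the left-hand condition of
    [dini_nonincreasing]. *)
Lemma dini_along_solution f G x a b : a <= b -> continuous G ->
  is_solution f `[a, b] x ->
  (forall t, a <= t < b -> forall e, 0 < e -> exists2 d, 0 < d &
     forall s, t < s < t + d -> s <= b -> G (x s) <= G (x t) + e * (s - t)) ->
  G (x b) <= G (x a).
Proof.
move=> ab Gc xs dini; apply: (dini_nonincreasing (g := G \o x)) => // t tab e e0.
have [d d0 dP] := (continuous_at_normP _ _).1 (Gc (x t)) e e0.
have [|d' d'0 d'P] := solution_cvg (t := t) xs _ d0.
  by rewrite /= in_itv/=; lra.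
exists d' => // s a_s std.
have := dP (x s); rewrite ltr_norml => /(_ _)/andP[|/= ? ?]; last lra.
by apply: d'P; rewrite /= ?in_itv/= ?ltr0_norm; lra.
Qed.

Lemma deriv_along_solution f G x a b t e : differentiable G (x t) ->
  is_solution f `[a, b] x -> a <= t <= b -> 0 < e -> exists2 d, 0 < d &
  forall s, t < s < t + d -> s <= b ->
    `|G (x s) - G (x t) - (s - t) * rcprod (gradient G (x t)) (f (x t))|
       <= e * (s - t).
Proof.
move=> dG /is_solutionP xs tab e0.
have tJ : `[a, b]%classic t by rewrite /= in_itv.
have [d d0 dP] := has_deriv_within_comp dG (xs t tJ) e0.
exists d => // s std sb.
have sJ : `[a, b]%classic s by rewrite /= in_itv/=; lra.
have st0 : `|s - t| = s - t by rewrite gtr0_norm; lra.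
have := dP s sJ; rewrite st0; apply; lra.
Qed.

Lemma lyapunov_nonincreasing f G x a b : a <= b ->
  (forall p, differentiable G p) -> is_solution f `[a, b] x ->
  (forall t, a <= t <= b -> rcprod (gradient G (x t)) (f (x t)) <= 0) ->
  G (x b) <= G (x a).
Proof.
move=> ab dG xs D0; apply: (dini_along_solution ab _ xs) => // [p|t tab e e0].
  exact: differentiable_continuous.
have tab' : a <= t <= b by lra.
have [d d0 dP] := deriv_along_solution (dG _) xs tab' e0.
exists d => // s std sb; have := dP s std sb; rewrite ler_norml => /andP[_].
by have := D0 t tab'; move: (rcprod _ _) => D; nra.
Qed.

(* If the derivative of [G] along the field is positive at a point of level [c],
   the hypothesis forbids leaving [G <= c] near that point. *)
Lemma sublevel_barrier f G x T c : 0 <= T ->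
  (forall p, differentiable G p) ->
  continuous (fun p => rcprod (gradient G p) (f p)) ->
  is_solution f `[0, T] x ->
  (forall t, 0 <= t <= T -> 0 < rcprod (gradient G (x t)) (f (x t)) ->
     G (x t) <= c) ->
  G (x 0) <= c -> G (x T) <= c.
Proof.
move=> T0 dG Dc xs barrier G0.
have Gc : continuous G by move=> p; exact: differentiable_continuous.
suff : Num.max (G (x T)) c <= Num.max (G (x 0)) c.
  by rewrite [leRHS]max_r// ge_max => /andP[].
apply: (dini_along_solution (G := fun p => Num.max (G p) c) _ _ xs) => //.
  by move=> p; exact: (continuous_max (Gc p) (@cst_continuous _ R c p)).
move=> t tT e e0; have tT' : 0 <= t <= T by lra.
have tJ : `[0, T]%classic t by rewrite /= in_itv.
have [D0|D0] := leP (rcprod (gradient G (x t)) (f (x t))) 0.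
  have [d d0 dP] := deriv_along_solution (dG _) xs tT' e0.
  exists d => // s std sb; rewrite ge_max.
  have est0 : 0 <= e * (s - t) by rewrite mulr_ge0//; lra.
  apply/andP; split; last by rewrite -[c in c <= _]addr0 lerD// le_max lexx orbT.
  have GxG : G (x t) <= Num.max (G (x t)) c by rewrite le_max lexx.
  have := dP s std sb; rewrite ler_norml => /andP[_].
  by move: D0; move: (rcprod _ _) => D D0; nra.
(* A positive derivative stays positive nearby, so [barrier] holds at all close times and the
   maximum is constantly [c]. *)
have [d d0 dP] := (continuous_at_normP _ _).1 (Dc (x t)) _ D0.
have [d' d'0 d'P] := solution_cvg xs tJ d0.
exists d' => // s std sb.
have sJ : `[0, T]%classic s by rewrite /= in_itv/=; lra.
have xst : `|x s - x t| < d by apply: d'P => //; rewrite gtr0_norm; lra.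
have Gs : G (x s) <= c.
  apply: barrier; first by lra.
  by have := dP _ xst; rewrite ltr_norml => /andP[? ?]; lra.
have Gt : G (x t) <= c by exact: barrier.
by rewrite !max_r// lerDl mulr_ge0//; lra.
Qed.

Lemma constant_along_solution f G (y : R -> 'cV[R]_n) :
  (forall p, differentiable G p) -> is_solution f setT y ->
  (forall t, G (y t) = G (y 0)) -> rcprod (gradient G (y 0)) (f (y 0)) = 0.
Proof.
move=> dG /is_solutionP ys Gy; set D := rcprod _ _.
have [//|D0] := eqVneq D 0.
have D20 : 0 < `|D| / 2 by rewrite divr_gt0// normr_gt0.
have [d d0 dP] := has_deriv_within_comp (dG (y 0)) (ys 0 I) D20.
have := dP (d / 2) I; rewrite subr0 gtr0_norm; last by lra.
rewrite /= Gy subrr sub0r normrN normrM gtr0_norm; last by lra.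
by move=> /(_ _); nra.
Qed.

End lyapunov.

Lemma continuous_add_sqrt (R : realType) (T : topologicalType) (g h : T -> R)
    (M : R) : continuous g -> continuous h ->
  continuous (fun p => g p + M * Num.sqrt (h p)).
Proof.
move=> gc hc p; apply: cvgD; first exact: gc.
apply: cvgM; first exact: cvg_cst.
apply: (@continuous_comp _ _ _ h Num.sqrt); first exact: hc.
exact: sqrt_continuous.
Qed.

Lemma enorm_tr (R : realType) m n (A : 'M[R]_(m, n)) : enorm A^T = enorm A.
Proof.
rewrite /enorm exchange_big; congr Num.sqrt; apply: eq_bigr => i _.
by apply: eq_bigr => j _; rewrite mxE.
Qed.

(** * Dissipation of [V] against growth of [theta] *)

Section closed_loop.
Context (R : realType) (n : nat) (V theta : 'cV[R]_n -> R).
Context (F : 'cV[R]_n -> 'cV[R]_n) (psi1 psi2 sigma : 'cV[R]_n -> R).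
Context (V_ge0 : forall x, 0 <= V x) (V_C1 : is_C1 V) (theta_C1 : is_C1 theta).
Context (critical_setE : critical_set V = [set x | V x = 0]).
Context (VF_le0 : forall x, rcprod (gradient V x) (F x) <= 0).
Context (thetaF_le0 : forall x, rcprod (gradient theta x) (F x) <= 0).
Context (psi1_gt0 : forall x, 0 < psi1 x) (psi2_gt0 : forall x, 0 < psi2 x).
Context (sigma_gt0 : forall x, 0 < sigma x).
Let f := closed_loop_field V theta F psi1 psi2 sigma.

Lemma V_dissipation x : rcprod (gradient V x) (f x) <=
  - (sigma x * psi2 x * enorm (gradient V x) ^+ 2).
Proof.
rewrite gradient_closed_loop mulrBr [sigma x * (psi2 x * _)]mulrA gerDr.
by rewrite pmulr_rle0// pmulr_rle0.
Qed.

(** The [F] term is nonpositive, and so are the last two terms together by Cauchy-Schwarz; only the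
    cross term with [psi2] can make [theta] grow. *)
Lemma theta_growth x : rcprod (gradient theta x) (f x) <=
  sigma x * psi2 x * (enorm (gradient V x) * enorm (gradient theta x)).
Proof.
have CS := rcprod_sqr_le (gradient V x) (gradient theta x).
set P := rcprod (gradient V x) _ in CS.
have absP : `|P| <= enorm (gradient V x) * enorm (gradient theta x).
  by rewrite -ler_sqr ?nnegrE ?mulr_ge0 ?sqrtr_ge0// real_normK ?num_real// exprMn.
rewrite gradient_theta_closed_loop -mulrA ler_pM2l// /switching_fun -/P.
rewrite real_normK ?num_real//.
have : psi1 x * rcprod (gradient theta x) (F x) <= 0 by rewrite pmulr_rle0.
have : psi2 x * - P <= psi2 x * (enorm (gradient V x) * enorm (gradient theta x)).
  by rewrite ler_pM2l// (le_trans _ absP)// -normrN ler_norm.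
by move: CS; lra.
Qed.

Lemma V_nonincreasing x a b : a <= b -> is_solution f `[a, b] x ->
  V (x b) <= V (x a).
Proof.
move=> ab xs; apply: (lyapunov_nonincreasing ab _ xs) => // [p|t _].
  by have [] := V_C1.
apply: le_trans (V_dissipation _) _.
by rewrite oppr_le0 mulr_ge0 ?sqr_ge0// ltW// mulr_gt0.
Qed.

Lemma V_eq0_gradient x : V x = 0 -> enorm (gradient V x) = 0.
Proof.
move=> Vx; have : [set p | V p = 0] x := Vx.
by rewrite -critical_setE.
Qed.

(* [sqrt V] decreases at least as fast as a multiple of the norm of the gradient
   of [V], which absorbs the possible growth of [theta]. *)
Lemma weighted_nonincreasing M x a b : 0 <= M -> a <= b ->
  is_solution f `[a, b] x ->
  (forall t, a <= t <= b ->
     2 * Num.sqrt (V (x t)) * enorm (gradient theta (x t)) <=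
     M * enorm (gradient V (x t))) ->
  theta (x b) + M * Num.sqrt (V (x b)) <= theta (x a) + M * Num.sqrt (V (x a)).
Proof.
move=> M0 ab xs slope.
have [dV _] := V_C1; have [dth _] := theta_C1.
have Vc : continuous V by move=> p; exact: differentiable_continuous.
have thc : continuous theta by move=> p; exact: differentiable_continuous.
apply: (dini_along_solution (G := fun p => theta p + M * Num.sqrt (V p)) _ _ xs) => //.
  exact: continuous_add_sqrt.
move=> t tab e e0; have tab' : a <= t <= b by lra.
have xst s : t < s -> s <= b -> is_solution f `[t, s] x.
  move=> ts sb; apply: is_solutionW xs => u; rewrite /= !in_itv/=; lra.
(* The square root is not differentiable at 0. There, however, [V] stays 0 and [theta_growth] makes
   the derivative of [theta] nonpositive. *)
have [V0|V0] := eqVneq (V (x t)) 0.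
  have [d d0 dP] := deriv_along_solution (dth _) xs tab' e0.
  exists d => // s std sb.
  have Vs : V (x s) = 0.
    have /andP[ts _] := std; have := V_nonincreasing (ltW ts) (xst s ts sb).
    by rewrite V0 => Vs; apply/eqP; rewrite eq_le Vs V_ge0.
  rewrite Vs V0 sqrtr0 mulr0 !addr0.
  have := theta_growth (x t); rewrite V_eq0_gradient// mul0r mulr0.
  have := dP s std sb; rewrite ler_norml => /andP[_].
  by move: (rcprod _ _) => D; nra.
have Vt0 : 0 < V (x t) by rewrite lt_neqAle eq_sym V0 V_ge0.
set q := Num.sqrt (V (x t)); have q0 : 0 < q by rewrite sqrtr_gt0.
have qq : q ^+ 2 = V (x t) by rewrite sqr_sqrtr.
have e1 : 0 < e / 2 by lra.
have M1 : 0 < M / (2 * q) + 1 by rewrite ltr_wpDl// divr_ge0// mulr_ge0// ltW.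
(* The remainder of [V] gets multiplied by [M / (2 * q)], the derivative of [M * sqrt] at
   [V (x t)]. *)
have e2 : 0 < e / 2 / (M / (2 * q) + 1) by rewrite divr_gt0.
have [d d0 dP] := deriv_along_solution (dth _) xs tab' e1.
have [d' d'0 d'P] := deriv_along_solution (dV _) xs tab' e2.
exists (Num.min d d') => [|s std sb]; first by rewrite lt_min d0.
have [std1 std2] : t < s < t + d /\ t < s < t + d'.
  by move: std; rewrite -ltrBlDl lt_min => /andP[-> /andP[? ?]]; split; lra.
have := dP s std1 sb; have := d'P s std2 sb.
rewrite !ler_norml => /andP[_ Vs] /andP[_ ths].
(* concavity of the square root *)
have conc : Num.sqrt (V (x s)) <= q + (V (x s) - V (x t)) / (2 * q).
  have p0 := sqrtr_ge0 (V (x s)).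
  have pp : Num.sqrt (V (x s)) ^+ 2 = V (x s) by rewrite sqr_sqrtr.
  rewrite -[in leRHS]pp -[in leRHS]qq.
  move: (Num.sqrt (V (x s))) p0 => p p0.
  have -> : q + (p ^+ 2 - q ^+ 2) / (2 * q) = p + (p - q) ^+ 2 / (2 * q).
    by field; rewrite gt_eqF.
  by rewrite lerDl divr_ge0 ?sqr_ge0// mulr_ge0// ltW.
set c := M / (2 * q) in M1 e2 Vs *.
have c0 : 0 <= c by rewrite divr_ge0// mulr_ge0// ltW.
have Mconc : M * Num.sqrt (V (x s)) <= M * q + c * (V (x s) - V (x t)).
  have -> : M * q + c * (V (x s) - V (x t)) =
      M * (q + (V (x s) - V (x t)) / (2 * q)).
    by rewrite /c; field; rewrite gt_eqF.
  by rewrite ler_wpM2l.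
set DV := rcprod (gradient V (x t)) _ in Vs.
set Dth := rcprod (gradient theta (x t)) _ in ths.
(* With [k = sigma * psi2] and [g], [h] the gradient norms of [V] and [theta], the sum is at most
   [k * g * (h - c * g)], and the slope hypothesis says [h <= c * g]. *)
have DD : Dth + c * DV <= 0.
  have k0 : 0 < sigma (x t) * psi2 (x t) by rewrite mulr_gt0.
  have := theta_growth (x t); have := V_dissipation (x t); rewrite -/DV -/Dth.
  have := slope t tab'; rewrite -/q.
  have := sqrtr_ge0 (\sum_i \sum_j gradient V (x t) i j ^+ 2).
  rewrite -/(enorm (gradient V (x t))).
  move: (enorm (gradient V (x t))) (enorm (gradient theta (x t))) k0.
  move: (sigma (x t) * psi2 (x t)) => k g h k0 g0 qh DVk Dk.
  have hc : h <= c * g.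
    by rewrite /c mulrAC ler_pdivlMr ?mulr_gt0//; lra.
  apply: (@le_trans _ _ (k * (g * h) + c * - (k * g ^+ 2))).
    by rewrite lerD// ler_wpM2l.
  have -> : k * (g * h) + c * - (k * g ^+ 2) = k * g * (h - c * g) by ring.
  by rewrite mulr_ge0_le0//; [rewrite mulr_ge0// ltW|lra].
have cV : c * (V (x s) - V (x t)) <= c * ((s - t) * DV) + e / 2 * (s - t).
  apply: (@le_trans _ _ (c * ((s - t) * DV + e / 2 / (c + 1) * (s - t)))).
    by rewrite ler_wpM2l//; lra.
  rewrite mulrDr lerD2l mulrA ler_wpM2r//; first by lra.
  by rewrite mulrC mulrAC ler_pdivrMr// ler_wpM2l//; lra.
have st0 : 0 < s - t by lra.
have : (s - t) * (Dth + c * DV) <= 0 by rewrite pmulr_rle0.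
have -> : (s - t) * (Dth + c * DV) = (s - t) * Dth + c * ((s - t) * DV) by ring.
by lra.
Qed.

(** On a compact set [gamma] and the gradient of [theta] are bounded, and [gP] gives
    [sqrt V <= sqrt gamma * |grad V|]. *)
Lemma slope_bound (Omega gamma : 'cV[R]_n -> R) (C : set 'cV[R]_n) :
  {within [set x | Omega x < 1], continuous gamma} ->
  (forall x, Omega x < 1 -> 0 < gamma x) ->
  (forall x, Omega x < 1 -> V x <= gamma x * enorm (gradient V x) ^+ 2) ->
  compact C -> (forall x, C x -> Omega x < 1) ->
  exists2 M, 0 <= M & forall x, C x ->
    2 * Num.sqrt (V x) * enorm (gradient theta x) <= M * enorm (gradient V x).
Proof.
move=> gc g0 gP cC COm.
have [A A0 CA] : exists2 A, 0 <= A & forall x, C x -> gamma x <= A.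
  have gC : {within C, continuous gamma} by apply: continuous_subspaceW gc.
  have /compact_bounded[B [_ BP]] := continuous_compact gC cC.
  exists (Num.max 0 (B + 1)); first by rewrite le_max lexx.
  move=> x Cx; rewrite le_max; apply/orP; right.
  by apply: le_trans (ler_norm _) _; apply: BP; [lra|exists x].
have [B B0 CB] : exists2 B, 0 <= B & forall x, C x -> enorm (gradient theta x) <= B.
  have gC : {within C, continuous (gradient theta)}.
    by apply: continuous_subspaceT; have [] := theta_C1.
  have /compact_bounded[B [_ BP]] := continuous_compact gC cC.
  exists (n.+1%:R * Num.max 0 (B + 1)) => [|x Cx].
    by rewrite mulr_ge0// le_max lexx.
  rewrite -enorm_tr.
  apply: le_trans (enorm_le_norm _) _; rewrite ler_wpM2l//.
  have grad0 : 0 <= Num.max 0 (B + 1) by rewrite le_max lexx.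
  apply: norm_le_entry => // i j; rewrite mxE.
  apply: le_trans (entry_le_norm _ _ _) _.
  by rewrite le_max; apply/orP; right; apply: BP; [lra|exists x].
exists (2 * Num.sqrt A * B) => [|x Cx]; first by rewrite !mulr_ge0// sqrtr_ge0.
have VA : Num.sqrt (V x) <= Num.sqrt A * enorm (gradient V x).
  have g_ge0 : 0 <= enorm (gradient V x) by exact: sqrtr_ge0.
  rewrite -[X in _ * X]ger0_norm// -sqrtr_sqr -sqrtrM// ler_wsqrtr//.
  apply: le_trans (gP x (COm x Cx)) _; rewrite ler_wpM2r ?sqr_ge0//.
  exact: CA.
have -> : 2 * Num.sqrt A * B * enorm (gradient V x) =
    2 * (Num.sqrt A * enorm (gradient V x)) * B by ring.
by rewrite ler_pM ?mulr_ge0 ?sqrtr_ge0 ?CB// ler_wpM2l.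
Qed.

End closed_loop.

(** * Boundedness, limit sets and trapping for the closed loop *)

Section asymptotics.
Context (R : realType) (n : nat).
Context (V theta Omega gamma psi1 psi2 sigma : 'cV[R]_n -> R).
Context (F : 'cV[R]_n -> 'cV[R]_n).
Context (V_ge0 : forall x, 0 <= V x).
Context (V_C1 : is_C1 V) (V_lip : locally_lipschitz (gradient V)).
Context (theta_C1 : is_C1 theta) (theta_lip : locally_lipschitz (gradient theta)).
Context (critical_setE : critical_set V = [set x | V x = 0]).
Context (sublevel_compact : forall z y, V y <= V z ->
  compact [set x | V x <= V z /\ theta x <= theta y]).
Context (Omega_cont : continuous Omega).
Context (Omega_eq0 : forall x, critical_set V x -> Omega x = 0).
Context (gamma_cont : {within [set x | Omega x < 1], continuous gamma}).
Context (gamma_gt0 : forall x, Omega x < 1 -> 0 < gamma x).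
Context (F_lip : locally_lipschitz F).
Context (gammaP : forall x, Omega x < 1 ->
  V x <= gamma x * enorm (gradient V x) ^+ 2).
Context (VF_le0 : forall x, rcprod (gradient V x) (F x) <= 0).
Context (thetaF_le0 : forall x, rcprod (gradient theta x) (F x) <= 0).
Context (psi1_lip : locally_lipschitz psi1) (psi1_gt0 : forall x, 0 < psi1 x).
Context (psi2_lip : locally_lipschitz psi2) (psi2_gt0 : forall x, 0 < psi2 x).
Context (switching_funP : forall z, exists yz,
  [/\ V yz <= V z, theta z <= theta yz &
      [set x | 0 < switching_fun V theta F psi1 psi2 x /\ V x <= V z]
        `<=` [set x | theta x <= theta yz]]).
Context (sigma_lip : locally_lipschitz sigma) (sigma_gt0 : forall x, 0 < sigma x).
Let f := closed_loop_field V theta F psi1 psi2 sigma.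
Implicit Types x : R -> 'cV[R]_n.

Let flip : lipschitz_on_balls f.
Proof. exact: closed_loop_lipschitz. Qed.

Let Vc : continuous V.
Proof. by move=> p; apply: differentiable_continuous; have [] := V_C1. Qed.

Let thc : continuous theta.
Proof. by move=> p; apply: differentiable_continuous; have [] := theta_C1. Qed.

Let sub_solution x a b : 0 <= a -> is_solution f `[0, +oo[ x -> is_solution f `[a, b] x.
Proof.
move=> a0; apply: is_solutionW => t; rewrite /= !in_itv/= andbT => /andP[at_ _].
exact: le_trans at_.
Qed.

Let Vdec x a b : a <= b -> is_solution f `[a, b] x -> V (x b) <= V (x a).
Proof. exact: V_nonincreasing. Qed.

Let Wdec M x a b : 0 <= M -> a <= b -> is_solution f `[a, b] x ->
  (forall t, a <= t <= b ->
     2 * Num.sqrt (V (x t)) * enorm (gradient theta (x t)) <=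
     M * enorm (gradient V (x t))) ->
  theta (x b) + M * Num.sqrt (V (x b)) <= theta (x a) + M * Num.sqrt (V (x a)).
Proof. exact: weighted_nonincreasing. Qed.

Let Vdecr x s t : is_solution f `[0, +oo[ x -> 0 <= s -> s <= t -> V (x t) <= V (x s).
Proof.
move=> xs s0 st; 
exact: (Vdec st (sub_solution s0 xs)).
Qed.

(** The compact set is a common sublevel set of [V] and [theta]: [V] never grows, and [theta] cannot
    cross the level [theta y], since it increases only where the switching function is positive. *)
Lemma closed_loop_solution_exists (x0 : 'cV[R]_n) : exists x K,
  [/\ is_solution f `[0, +oo[ x, x 0 = x0, compact K & forall t, 0 <= t -> K (x t)].
Proof.
have [y [Vy thy sw]] := switching_funP x0.
have cK := (@sublevel_compact _ _ Vy).
have [||x [xs xx0 xK]] := confined_solution_exists (x0 := x0) flip cK _ _.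
- by split.
- move=> x T T0 xs xx0.
  have Vx t : 0 <= t <= T -> V (x t) <= V x0.
    move=> /andP[t0 tT]; rewrite -xx0.
    apply: (Vdec t0).
    by apply: is_solutionW xs => u; rewrite /= !in_itv/= => /andP[-> /le_trans->].
  split; first by apply: Vx; rewrite T0 lexx.
  apply: (sublevel_barrier T0 _ _ xs) => [p||t tT|].
  + by have [] := theta_C1.
  + apply: lipschitz_on_balls_continuous; apply: lipschitz_on_balls_entry.
    by apply: lipschitz_on_balls_mulmx => //; exact: locally_lipschitz_on_balls.
  + rewrite gradient_theta_closed_loop pmulr_rgt0// => sw0.
    by apply: sw; split => //; exact: Vx.
  + by rewrite xx0.
by exists x; exists [set p | V p <= V x0 /\ theta p <= theta y].
Qed.

Lemma closed_loop_solution_confined x : is_solution f `[0, +oo[ x ->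
  exists2 K, compact K & forall t, 0 <= t -> K (x t).
Proof.
move=> xs; have [y [K [ys yx0 cK yK]]] := closed_loop_solution_exists (x 0).
exists K => // t t0; have [_ _ uniq] := solution_unique flip xs.
rewrite -(uniq `[0, +oo[%classic y) //; first exact: yK.
- exact: interval_is_interval.
- by rewrite /= in_itv/= lexx.
- by rewrite /= in_itv/= t0.
Qed.

Lemma critical_setP p : critical_set V p <-> V p = 0.
Proof. by rewrite critical_setE. Qed.

(** LaSalle's argument: [V] is constant on the orbit through a limit point, so the dissipation, and
    with it the gradient of [V], vanishes there. *)
Lemma limit_set_critical x : is_solution f `[0, +oo[ x ->
  positive_limit_set x `<=` critical_set V.
Proof.
move=> xs p px; have [K cK xK] := closed_loop_solution_confined xs.
have [y [ys <- yx]] := limit_set_orbit flip cK xs xK px.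
have Vy t : V (y t) = V (y 0).
  apply: (limit_set_monotone_const (T := 0) Vc _ (yx t) (yx 0)).
  by move=> s u; exact: Vdecr.
have [dV _] := V_C1.
have := V_dissipation theta psi2 VF_le0 psi1_gt0 sigma_gt0 (y 0).
rewrite (constant_along_solution dV ys Vy) oppr_ge0 pmulr_rle0 ?mulr_gt0//.
move=> E0; apply/eqP; rewrite -sqrf_eq0 eq_le E0; exact: sqr_ge0.
Qed.

(** LaSalle's argument once more, for [theta + M * sqrt V], which is nonincreasing once the
    trajectory is close to [S]. *)
Lemma limit_set_zero_dissipation x : is_solution f `[0, +oo[ x ->
  positive_limit_set x `<=` [set p | rcprod (gradient theta p) (F p) = 0].
Proof.
move=> xs p px; have [K cK xK] := closed_loop_solution_confined xs.
have wS := limit_set_critical xs.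
(* The level 1/2 gives a closed set inside the region [Omega < 1] where [gammaP] holds. *)
have cC : compact (K `&` [set q | Omega q <= 1 / 2]).
  apply: compact_closedI => //.
  by apply: (@closed_comp _ _ Omega [set r | r <= 1 / 2]) => [q _|];
    [exact: Omega_cont|exact: closed_le].
have [|M M0 MP] := slope_bound theta_C1 gamma_cont gamma_gt0 gammaP cC.
  by move=> q [_ /= Oq]; lra.
(* Otherwise some limit point would have [Omega >= 1 / 2], whereas limit points lie in [S], where
   [Omega] is 0. *)
have [T T0 xT] : exists2 T, 0 <= T & forall t, T <= t -> Omega (x t) <= 1 / 2.
  apply: contrapT => nT.
  have late T : exists2 t, T <= t & [set q | 1 / 2 <= Omega q] (x t).
    apply: contrapT => nt; apply: nT; exists (Num.max 0 T).
      by rewrite le_max lexx.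
    move=> t; rewrite ge_max => /andP[t0 Tt]; rewrite leNgt; apply/negP => Ot.
    by apply: nt; exists t => //; exact: ltW.
  have cO : closed [set q | 1 / 2 <= Omega q].
    by apply: (@closed_comp _ _ Omega [set r | 1 / 2 <= r]) => [q _|];
      [exact: Omega_cont|exact: closed_ge].
  have [q /wS/Omega_eq0 Oq [_ /=]] := late_limit_point cK xK cO late.
  by rewrite Oq; lra.
have [y [ys <- yx]] := limit_set_orbit flip cK xs xK px.
have [dth _] := theta_C1.
have V0 t : V (y t) = 0 by apply/critical_setP/wS/yx.
(* On the limit set [V] is 0, so the weighted function reduces to [theta]. *)
have thy t : theta (y t) = theta (y 0).
  have := @limit_set_monotone_const _ _ x _ T _ _
    (continuous_add_sqrt (M := M) thc Vc) _ (yx t) (yx 0).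
  rewrite !V0 sqrtr0 mulr0 !addr0; apply=> s u Ts su.
  apply: (Wdec M0 su).
    by apply: sub_solution => //; lra.
  move=> v sv; apply: MP; split; first by apply: xK; lra.
  by apply: xT; lra.
have := constant_along_solution dth ys thy.
rewrite gradient_theta_closed_loop => /eqP; rewrite mulf_eq0 gt_eqF//=.
have grad0 : enorm (gradient V (y 0)) = 0 by exact: V_eq0_gradient.
have := rcprod_sqr_le (gradient V (y 0)) (gradient theta (y 0)).
rewrite /switching_fun grad0 expr0n mul0r => P0.
(* Where the gradient of [V] vanishes, the switching function reduces to its [F] term. *)
have -> : rcprod (gradient V (y 0)) (gradient theta (y 0))^T = 0.
  by apply/eqP; rewrite -sqrf_eq0 eq_le P0 sqr_ge0.
rewrite normr0 expr0n /= mulr0 !subr0 addr0 mulf_eq0 gt_eqF//=.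
by move/eqP.
Qed.

(** To reach the sphere, a trajectory would need [V >= k] or [theta >= theta xs + k] there, while
    [V] and [theta + M * sqrt V] start below these levels and do not increase inside the ball. *)
Lemma local_minimum_trapping (xs : 'cV[R]_n) r : critical_set V xs -> 0 < r ->
  (forall p, critical_set V p -> p <> xs -> `|p - xs| <= r -> theta xs < theta p) ->
  (forall p, `|p - xs| <= r -> Omega p < 1) ->
  exists2 d, 0 < d & forall x, is_solution f `[0, +oo[ x -> `|x 0 - xs| < d ->
    forall t, 0 <= t -> `|x t - xs| < r.
Proof.
move=> Sxs r0 thmin Or.
have Vxs : V xs = 0 by exact/critical_setP.
pose sphere := [set p : 'cV[R]_n | `|p - xs| = r].
have csphere : compact sphere.
  apply: (@subclosed_compact _ _ [set p | `|p - xs| <= r]).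
  - apply: (@closed_comp _ _ (fun p : 'cV[R]_n => `|p - xs|) [set s | s = r]).
      by move=> p _; exact: dist_continuous.
    exact: closed_eq.
  - exact: closed_ball_compact.
  - by move=> p /= ->.
(* Positive on the sphere: off [S] because of [V], on [S] because of the strict minimum of
   [theta]. *)
pose h p := Num.max (V p) (theta p - theta xs).
have hc : continuous h.
  have thc' : continuous (fun p => theta p - theta xs).
    move=> p; apply: (@continuous_comp _ _ _ theta (fun s => s - theta xs)).
      exact: thc.
    by apply: cvgB; [exact: cvg_id|exact: cvg_cst].
  by rewrite /h => p; apply: (continuous_max (f := V)); [exact: Vc|exact: thc'].
have [k k0 hk] : exists2 k, 0 < k & forall p, sphere p -> k <= h p.
  (* The sphere is empty when [n = 0], and the minimum needs a point. *)
  have [sphere0|nsphere] := pselect (sphere !=set0); last first.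
    by exists 1 => // p ps; exfalso; apply: nsphere; exists p.
  have hcs : {within sphere, continuous h} by exact: continuous_subspaceT.
  have [c /[!inE] cs hmin] := compact_EVT_min sphere0 csphere hcs.
  exists (h c) => [|p ps]; last by apply: hmin; rewrite inE.
  rewrite lt_max; have [//|Vc0] := ltP 0 (V c); apply/orP; right.
  rewrite subr_gt0; apply: thmin; last by rewrite cs.
    by apply/critical_setP/eqP; rewrite eq_le Vc0 V_ge0.
  by move=> cxs; move: cs; rewrite /sphere/= cxs subrr normr0 => r00; lra.
have [M M0 MP] := slope_bound theta_C1 gamma_cont gamma_gt0 gammaP
  (@closed_ball_compact _ _ xs r) Or.
have [d1 d10 d1P] := (continuous_at_normP V xs).1 (@Vc xs) k k0.
have [d2 d20 d2P] :=
  (continuous_at_normP _ _).1 (@continuous_add_sqrt _ _ _ _ M thc Vc xs) k k0.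
exists (Num.min r (Num.min d1 d2)); first by rewrite !lt_min r0 d10.
move=> x xsol; rewrite !lt_min => /and3P[x0r /d1P V0 /d2P W0].
move: V0 W0; rewrite Vxs subr0 sqrtr0 mulr0 addr0.
rewrite ger0_norm// ltr_norml => V0 /andP[_ W0].
have stay T : 0 <= T -> (forall t, 0 <= t <= T -> `|x t - xs| <= r) ->
    `|x T - xs| <> r.
  move=> T0 xr sphT; have := hk _ sphT; rewrite le_max => /orP[kV|kth].
    by have := Vdecr xsol (lexx 0) T0; lra.
  have : theta (x T) + M * Num.sqrt (V (x T)) <= theta (x 0) + M * Num.sqrt (V (x 0)).
    apply: (Wdec M0 T0); first exact: sub_solution.
    by move=> t tT; apply: MP; exact: xr.
  have : 0 <= M * Num.sqrt (V (x T)) by rewrite mulr_ge0// sqrtr_ge0.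
  lra.
have cvgx t e : 0 <= t -> 0 < e -> exists2 d, 0 < d &
    forall s, 0 <= s -> `|s - t| < d -> `|x s - x t| < e.
  move=> t0 e0; have [|d d0 dP] := solution_cvg (t := t) xsol _ e0.
    by rewrite /= in_itv/= t0.
  by exists d => // s s0 std; apply: dP => //; rewrite /= in_itv/= s0.
have tri s t : `|x s - xs| <= `|x s - x t| + `|x t - xs|.
  by rewrite -[x s - xs](subrKA (x t)) ler_normD.
apply: real_induction => // [t t0 xt|t t0 xt].
  have xtr : 0 < r - `|x t - xs| by rewrite subr_gt0 xt// t0 lexx.
  have [d d0 dP] := cvgx t _ t0 xtr; exists d => // s std.
  have xst : `|x s - x t| < r - `|x t - xs|.
    by apply: dP; rewrite ?gtr0_norm; lra.
  by have := tri s t; lra.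
have xr s : 0 <= s <= t -> `|x s - xs| <= r.
  move=> /andP[s0]; rewrite le_eqVlt => /predU1P[->|st]; last first.
    by rewrite ltW// xt// s0.
  apply/ler_addgt0Pr => e e0; have [d d0 dP] := cvgx t e (ltW t0) e0.
  pose u := Num.max 0 (t - d / 2).
  have u0 : 0 <= u by rewrite le_max lexx.
  have ut : u < t by rewrite gt_max t0; lra.
  have du : t - d < u by rewrite lt_max; apply/orP; right; lra.
  have xut : `|x u - x t| < e by apply: dP; rewrite ?ltr0_norm; lra.
  have xur : `|x u - xs| < r by apply: xt; rewrite u0.
  by have := tri t u; rewrite [`|x t - x u|]distrC; lra.
(* Continuity only gives the non-strict bound at [t]; [stay] excludes equality. *)
rewrite lt_neqAle xr ?lexx ?ltW// andbT; apply/eqP.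
by apply: stay => //; exact: ltW.
Qed.

End asymptotics.

(** * Global existence, limit sets and asymptotic stability *)

Theorem theorem4p2 (R : realType) (n : nat)
    (V theta Omega gamma psi1 psi2 sigma : 'cV[R]_n -> R)
    (F : 'cV[R]_n -> 'cV[R]_n)
    (V_ge0 : forall x, 0 <= V x)
    (V_C1 : is_C1 V) (V_lip : locally_lipschitz (gradient V))
    (theta_C1 : is_C1 theta) (theta_lip : locally_lipschitz (gradient theta))
    (critical_setE : critical_set V = [set x | V x = 0])
    (sublevel_compact : forall z y, V y <= V z ->
       compact [set x | V x <= V z /\ theta x <= theta y])
    (Omega_ge0 : forall x, 0 <= Omega x)
    (Omega_cont : continuous Omega) (Omega_lip : locally_lipschitz Omega)
    (Omega_gt0 : forall x, ~ critical_set V x -> 0 < Omega x)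
    (Omega_eq0 : forall x, critical_set V x -> Omega x = 0)
    (gamma_cont : {within [set x | Omega x < 1], continuous gamma})
    (gamma_gt0 : forall x, Omega x < 1 -> 0 < gamma x)
    (F_lip : locally_lipschitz F)
    (gammaP : forall x, Omega x < 1 ->
       V x <= gamma x * enorm (gradient V x) ^+ 2)
    (VF_le0 : forall x, rcprod (gradient V x) (F x) <= 0)
    (thetaF_le0 : forall x, rcprod (gradient theta x) (F x) <= 0)
    (psi1_lip : locally_lipschitz psi1) (psi1_gt0 : forall x, 0 < psi1 x)
    (psi2_lip : locally_lipschitz psi2) (psi2_gt0 : forall x, 0 < psi2 x)
    (switching_funP : forall z, exists yz,
       [/\ V yz <= V z, theta z <= theta yz &
           [set x | 0 < switching_fun V theta F psi1 psi2 x /\ V x <= V z]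
             `<=` [set x | theta x <= theta yz]])
    (sigma_lip : locally_lipschitz sigma) (sigma_gt0 : forall x, 0 < sigma x) :
  let S := critical_set V in
  let f := closed_loop_field V theta F psi1 psi2 sigma in
  let E := [set x | S x /\ rcprod (gradient theta x) (F x) = 0] in
  [/\ forall x0, exists x, is_unique_solution f `[0, +oo[ x0 x /\
        bounded_set (x @` `[0, +oo[),
      positively_invariant f S,
      forall x0 x, is_unique_solution f `[0, +oo[ x0 x ->
        let omega := positive_limit_set x in
        [/\ omega !=set0, compact omega, connected omega,
            flow_invariant f omega & omega `<=` E] &
      forall xs, S xs -> F xs = 0 ->
        (exists2 delta : R, 0 < delta &
           (forall x, S x -> x <> xs -> enorm (x - xs) < delta ->
              theta xs < theta x) /\
           E `&` [set x | enorm (x - xs) < delta] = [set xs]) ->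
        locally_asymptotically_stable_equilibrium f xs].
Proof.
move=> S f E.
have flip : lipschitz_on_balls f by exact: closed_loop_lipschitz.
have exsol x0 : exists x K, [/\ is_solution f `[0, +oo[ x, x 0 = x0,
    compact K & forall t, 0 <= t -> K (x t)].
  by apply: (@closed_loop_solution_exists R n V theta psi1 psi2 sigma F).
have SV p : S p <-> V p = 0 by rewrite /S critical_setE.
split.
- move=> x0; have [x [K [xs xx0 cK xK]]] := exsol x0.
  exists x; split; first by rewrite -xx0; exact: solution_unique.
  have [M [Mreal MP]] := compact_bounded cK; exists M; split => // N MN _ [t t0 <-].
  by apply: MP => //; apply: xK; move: t0; rewrite /= in_itv/= andbT.
- move=> p /SV Vp; have [x [_ [xs xx0 _ _]]] := exsol p.
  exists x; split; first by rewrite -xx0; exact: solution_unique.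
  move=> t t0; apply/SV/eqP; rewrite eq_le V_ge0 andbT -Vp -xx0.
  apply: (@V_nonincreasing R n V theta F psi1 psi2 sigma) => //.
  by apply: is_solutionW xs => u; rewrite /= !in_itv/= => /andP[->].
- move=> x0 x [xs xx0 _] omega.
  have [K cK xK] : exists2 K, compact K & forall t, 0 <= t -> K (x t).
    by apply: (@closed_loop_solution_confined R n V theta psi1 psi2 sigma F).
  have cKl : closed K by exact: compact_closed (@norm_hausdorff _ _) cK.
  split.
  (* Taking the whole space as closed set gives non-emptiness. *)
  + have [|p op _] := late_limit_point cK xK closedT; last by exists p.
    by move=> T; exists T.
  + apply: (subclosed_compact (@positive_limit_set_closed _ _ x) cK).
    exact: positive_limit_set_sub.
  + exact: limit_set_connected cK xs xK.
  + exact: limit_set_invariant cK xs xK.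
  + move=> p op; split.
      by apply: (@limit_set_critical R n V theta psi1 psi2 sigma F) op.
    by apply: (@limit_set_zero_dissipation R n V theta Omega gamma psi1 psi2 sigma F) op.
move=> xs Sxs Fxs [delta delta0 [thmin Exs]].
have n0 : 0 < n.+1%:R :> R by rewrite ltr0n.
(* The factor [n.+1] converts the sup norm into the Euclidean one. The radius [r] serves both [e]
   and [delta]; halving [delta] keeps the closed ball strictly inside the given neighbourhood. *)
have trap e : 0 < e -> exists r d, [/\ 0 < d, n.+1%:R * r <= Num.min e (delta / 2) &
    forall x0, enorm (x0 - xs) < d -> exists x,
      is_unique_solution f `[0, +oo[ x0 x /\ forall t, 0 <= t -> `|x t - xs| < r].
  move=> e0; have [d0 d00 dO] :=
    (continuous_at_normP Omega xs).1 (Omega_cont xs) 1 ltr01.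
  pose m := Num.min e (delta / 2).
  have m0 : 0 < m by rewrite lt_min e0 divr_gt0.
  have rP : n.+1%:R * Num.min (m / n.+1%:R) (d0 / 2) <= m.
    by rewrite mulrC -ler_pdivlMr// ge_min lexx.
  set r := Num.min _ _ in rP.
  have r0 : 0 < r by rewrite lt_min !divr_gt0.
  have rd0 : r < d0.
    by apply: (@le_lt_trans _ _ (d0 / 2)); [rewrite ge_min lexx orbT|lra].
  have rdelta p : `|p - xs| <= r -> enorm (p - xs) < delta.
    move=> pr; apply: le_lt_trans (enorm_le_norm _) _.
    apply: le_lt_trans (ler_wpM2l (ltW n0) pr) _; apply: le_lt_trans rP _.
    by rewrite /m gt_min; apply/orP; right; lra.
  have [d dpos dP] : exists2 d, 0 < d & forall x, is_solution f `[0, +oo[ x ->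
      `|x 0 - xs| < d -> forall t, 0 <= t -> `|x t - xs| < r.
    apply: (@local_minimum_trapping R n V theta Omega gamma psi1 psi2 sigma F) => //.
      by move=> p Sp pxs pr; apply: thmin => //; exact: rdelta.
    move=> p pr; have := dO p (le_lt_trans pr rd0).
    by rewrite (Omega_eq0 _ Sxs) subr0 ger0_norm.
  exists r, d; split => // x0 x0d; have [x [_ [xsol xx0 _ _]]] := exsol x0.
  exists x; split; first by rewrite -xx0; exact: solution_unique.
  by apply: dP => //; rewrite xx0; exact: le_lt_trans (norm_le_enorm _) x0d.
have trapE e r p : n.+1%:R * r <= Num.min e (delta / 2) -> `|p - xs| <= r ->
    enorm (p - xs) < delta.
  rewrite le_min => /andP[_ rd] pr; apply: le_lt_trans (enorm_le_norm _) _.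
  by apply: le_lt_trans (ler_wpM2l (ltW n0) pr) _; lra.
split.
- rewrite /f closed_loop_fieldE Fxs.
  have grad0 : gradient V xs = 0.
    apply/trmx_inj/eqP; rewrite trmx0 -normr_le0 (le_trans (norm_le_enorm _))//.
    by rewrite enorm_tr Sxs.
  by rewrite Sxs grad0 trmx0 expr0n/= !scaler0 scale0r !subr0 scaler0.
- move=> e e0; have [r [d [d0 re dP]]] := trap e e0; exists d => // x0 /dP[x [ux xr]].
  exists x; split => // t /xr xtr; apply: le_lt_trans (enorm_le_norm _) _.
  by move: re; rewrite le_min => /andP[re _]; apply: lt_le_trans re; rewrite ltr_pM2l.
(* For attractivity only the bound by [delta] matters, so 1 is an arbitrary choice. *)
have [r [d [d0 re dP]]] := trap 1 ltr01; exists d => // x0 /dP[x [ux xr]].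
exists x; split => //; have [xsol _ _] := ux.
have cB := @closed_ball_compact _ _ xs r.
have xB t : 0 <= t -> [set p | `|p - xs| <= r] (x t) by move=> /xr /ltW.
apply/cvgrPdist_lt => e e0; apply: contrapT => nlim.
(* Without convergence, the trapped trajectory would have a limit point at distance at least [e]
   from [xs], but [xs] is the only point of [E] in the trapping ball. *)
have late T : exists2 t, T <= t & [set p | e <= `|p - xs|] (x t).
  apply: contrapT => nT; apply: nlim; exists T; split; first exact: num_real.
  move=> t /= Tt; rewrite distrC ltNge; apply/negP => et; apply: nT.
  by exists t => //; exact: ltW.
have cC : closed [set p | e <= `|p - xs|].
  apply: (@closed_comp _ _ (fun p : 'cV[R]_n => `|p - xs|) [set s | e <= s]).
    by move=> p _; exact: dist_continuous.
  exact: closed_ge.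
have [p op [pr /= ep]] := late_limit_point cB xB cC late.
have : (E `&` [set q | enorm (q - xs) < delta]) p.
  split; last exact: (trapE 1 r).
  split.
    by apply: (@limit_set_critical R n V theta psi1 psi2 sigma F) op.
  by apply: (@limit_set_zero_dissipation R n V theta Omega gamma psi1 psi2 sigma F) op.
by rewrite Exs => pxs; move: ep; rewrite pxs subrr normr0; lra.
Qed.
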